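(* Let $w\in S_N$ avoid the pattern $321$ and put $v=w^{-1}$. Write $F(w)=\{i:w(i)>i\}=\{f_1<\cdots<f_t\}$ and $G(w)=w(F(w))=\{g_1<\cdots<g_t\}$. Then $$\mathfrak S_w(c)=\det\bigl(h_{g_i-f_j}(f_j)\bigr)_{1\le i,j\le t}=\Delta_{G(w)^c,F(w)^c}(Z(c))=\Delta_{I(v),J(v)}(Z(c)),$$ where $I(v)=\{i:v(i)>i\}$ and $J(v)=v(I(v))$.
   Context: $U_N$ is the group of upper unitriangular $N\times N$ matrices, $\mathbb Z[U_N]=\mathbb Z[z_{p,q}:1\le p<q\le N]$, $c_r(k)=z_{k+1-r,k+1}$ for $1\le r\le k\le N-1$, $c_0(k)=1$, $c_r(k)=0$ for $r<0$ or $r>k$. $Z(c)$ is the upper unitriangular matrix with $Z(c)_{p,q}=c_{q-p}(q-1)$ for $p\le q$. $\Delta_{I,J}$ denotes the minor with row set $I$ and column set $J$; $A^c=\{1,\dots,N\}\setminus A$. Put $$h_r(p)=\det Z(c)_{[p,p+r-1],[p+1,p+r]}=(-1)^r(Z(c)^{-1})_{p,p+r},$$ so $h_0(p)=1$ and $h_r(p)=0$ for $r<0$. Universal Schubert polynomials: every classical Schubert polynomial $\mathfrak S_w(x)$, $w\in S_N$, has a unique expansion $\mathfrak S_w(x)=\sum a_{i_1,\dots,i_{N-1}}e_{i_1}(x_1)e_{i_2}(x_1,x_2)\cdots e_{i_{N-1}}(x_1,\dots,x_{N-1})$ with $0\le i_k\le k$; then $\mathfrak S_w(c)=\sum a_{i_1,\dots,i_{N-1}}c_{i_1}(1)\cdots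 c_{i_{N-1}}(N-1)\in\mathbb Z[U_N]$. *)

(* Defs.v *)
From HB Require Import structures.
From mathcomp Require Import all_boot all_order all_fingroup all_algebra.
From mathcomp Require Export mpoly.
From Stdlib Require Export ClassicalEpsilon.

Set Implicit Arguments.
Unset Strict Implicit.
Unset Printing Implicit Defensive.

Import GRing.Theory.
Local Open Scope ring_scope.

(* Positions, values and indices are elements of 'I_N: the 1-based index a of
   the usual notation is the ordinal of value a - 1. *)

Definition avoids_321 (N : nat) (w : 'S_N) : Prop :=
  forall i j k : 'I_N, (i < j)%N -> (j < k)%N -> ~ ((w k < w j)%N /\ (w j < w i)%N).

Definition exc (N : nat) (w : 'S_N) : {set 'I_N} := [set i : 'I_N | (i < w i)%N].

Definition exc_val (N : nat) (w : 'S_N) : {set 'I_N} := w @: exc w.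

Lemma card_exc_val (N : nat) (w : 'S_N) : #|exc w| = #|exc_val w|.
Proof. by rewrite card_imset //; apply: perm_inj. Qed.

(* [enum_val] lists a subset of 'I_N in increasing order, so these are
   f_1 < ... < f_t and g_1 < ... < g_t (and [minor] below keeps rows and columns
   in their natural order). *)
Definition exc_nth (N : nat) (w : 'S_N) (j : 'I_#|exc w|) : 'I_N := enum_val j.

Definition exc_val_nth (N : nat) (w : 'S_N) (i : 'I_#|exc w|) : 'I_N :=
  enum_val (cast_ord (card_exc_val w) i).

(* Meaningful when #|I| = #|J|. *)
Definition minor (R : comNzRingType) (N : nat) (A : 'M[R]_N) (I J : {set 'I_N}) : R :=
  \det (conform_mx (0 : 'M[R]_#|I|)
          (\matrix_(i < #|I|, j < #|J|) A (enum_val i) (enum_val j))).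

Definition upos (N : nat) : predArgType :=
  {pq : 'I_N * 'I_N | (pq.1 < pq.2)%N}.
HB.instance Definition _ (N : nat) := Finite.on (upos N).

(* The coordinate ring of U_N over int, one variable per position above the
   diagonal. *)
Definition ZU (N : nat) : comNzRingType := {mpoly int[#|{: upos N}|]}.

Definition zvar (N : nat) (p q : 'I_N) : ZU N :=
  if (insub (p, q) : option (upos N)) is Some u then 'X_(enum_rank u) else 0.

Definition ord_subn (N : nat) (k : 'I_N) (r : nat) : 'I_N :=
  Ordinal (leq_ltn_trans (leq_subr r k) (ltn_ord k)).

(* c_r(k) for 0 <= k <= N - 1. Here k is not an index into 1..N, so it is not
   shifted: the 1-based z_{k+1-r, k+1} is the 0-based z_{k-r, k}. *)
Definition cvar (N : nat) (r : int) (k : 'I_N) : ZU N :=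
  match r with
  | Posz 0 => 1
  | Posz r => if (r <= k)%N then zvar (ord_subn k r) k else 0
  | Negz _ => 0
  end.

Definition Zc (N : nat) : 'M[ZU N]_N :=
  \matrix_(p, q) if (p <= q)%N then cvar (q%:Z - p%:Z) q else 0.

Definition hvar (N : nat) (r : int) (p : 'I_N) : ZU N :=
  match r with
  | Posz r => minor (Zc N) [set i : 'I_N | (p <= i < p + r)%N]
                           [set j : 'I_N | (p < j <= p + r)%N]
  | Negz _ => 0
  end.

Lemma divdiff_ex (N : nat) (i j : 'I_N) (f : {mpoly int[N]}) :
  exists g : {mpoly int[N]}, ('X_i - 'X_j) * g == f - msym (tperm i j) f.
Proof.
set s := tperm i j.
pose P (f : {mpoly int[N]}) := exists g, ('X_i - 'X_j) * g = f - msym s f.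
suff: P f by case=> g Hg; exists g; apply/eqP.
have PC (a : int) : P a%:MP.
  exists 0; have -> : a%:MP_[N] = a *: 1 by rewrite -mul_mpolyC mulr1.
  by rewrite mulr0 msymZ msym1 subrr.
have PM p q : P p -> P q -> P (p * q).
  move=> [a Ha] [b Hb]; exists (a * q + msym s p * b).
  rewrite mulrDr mulrA Ha mulrCA Hb msymM mulrBl mulrBr addrA.
  by rewrite subrK.
have PD p q : P p -> P q -> P (p + q).
  move=> [a Ha] [b Hb]; exists (a + b).
  by rewrite mulrDr Ha Hb msymD opprD addrACA.
have PX k : P 'X_k.
  have sX : msym s 'X_k = 'X_(s k) :> {mpoly int[N]}.
    rewrite msymX; congr 'X_[_]; apply/mnmP=> l; rewrite !mnmE.
    by rewrite -(inj_eq (@perm_inj _ s)) permKV.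
  rewrite /P sX /s; case: tpermP => [->|->|_ _].
  - by exists 1; rewrite mulr1.
  - by exists (-1); rewrite mulrN1 opprB.
  - by exists 0; rewrite mulr0 subrr.
elim/mpolyind: f => [|c m p _ _ IH]; first by rewrite -(mpolyC0 N int); apply: PC.
apply: PD => //; rewrite -mul_mpolyC; apply: (PM); first exact: PC.
rewrite mpolyXE_id; apply: (big_ind P) => [|p1 p2|k _]; [|exact: PM|].
  by rewrite -(mpolyC1 N int); apply: PC.
elim: (m k) => [|e IHe]; first by rewrite expr0 -(mpolyC1 N int); apply: PC.
by rewrite exprS; apply: PM.
Qed.

(* The divided difference (f - s_ij f) / (x_i - x_j), for i != j. *)
Definition divdiff (N : nat) (i j : 'I_N) (f : {mpoly int[N]}) : {mpoly int[N]} :=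
  xchoose (divdiff_ex i j f).

(* Lascoux-Schuetzenberger: S_{w0} = x_1^{N-1} x_2^{N-2} ... x_{N-1}, and
   S_w = d_i S_{w s_i} whenever w(i) < w(i+1); the result does not depend on the
   ascent used. Permutations of MathComp compose from left to right, so w s_i
   (swap the values at positions i and i+1) is [tperm i j * w]. The first
   argument bounds the number of steps; w0 is reached after at most 'C(N, 2). *)
Fixpoint schubert_rec (N : nat) (l : nat) (w : 'S_N) : {mpoly int[N]} :=
  let top := \prod_(i < N) 'X_i ^+ (N - i.+1) in
  if l is l'.+1 then
    if [pick ij : 'I_N * 'I_N | (ij.2 == ij.1.+1 :> nat) && (w ij.1 < w ij.2)%N]
      is Some (i, j) then divdiff i j (schubert_rec l' (tperm i j * w)%g)
    else top
  else top.

Definition schubert (N : nat) (w : 'S_N) : {mpoly int[N]} :=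
  schubert_rec 'C(N, 2) w.

(* e_r(x_1, ..., x_k) *)
Definition elem_sym (N : nat) (r k : nat) : {mpoly int[N]} :=
  \sum_(A : {set 'I_N} | (A \subset [set i : 'I_N | (i < k)%N]) && (#|A| == r))
     \prod_(i in A) 'X_i.

(* Multi-indices (i_k) with 0 <= i_k <= k. The index k runs over 0..N-1 rather than
   1..N-1; the extra i_0 is forced to be 0, and its factors e_0() and c_0(0) are 1. *)
Definition multi_index (N : nat) : finType := {dffun forall k : 'I_N, 'I_k.+1}.

Definition elem_expansion (N : nat) (w : 'S_N) (a : multi_index N -> int) : Prop :=
  schubert w = \sum_(m : multi_index N) a m *: \prod_(k < N) elem_sym N (m k) k.

(* The coefficients of the unique such expansion. *)
Definition elem_coef (N : nat) (w : 'S_N) : multi_index N -> int :=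
  epsilon (inhabits (fun=> 0)) (elem_expansion w).

Definition universal_schubert (N : nat) (w : 'S_N) : ZU N :=
  \sum_(m : multi_index N) (\prod_(k < N) cvar (m k : nat) k) *~ elem_coef w m.

(* Main.v *)
Require Import Defs.
From mathcomp Require Import all_boot all_order all_fingroup all_algebra.
From mathcomp Require Import zify ring.

Set Implicit Arguments.
Unset Strict Implicit.
Unset Printing Implicit Defensive.

Import GRing.Theory.

(** Everything is reduced to determinants of full N x N matrices, in which a
    principal minor on a set S is obtained by making the rows outside S unit
    rows ([principal_mx], [det_principal]). This suits the theorem because a
    321-avoiding w is increasing on its set F of excedances ([exc_gt]) and on
    the complement of F ([nonexc_lt]): the minor with rows w(S) and columns S is
    the principal minor on S of the row-permuted matrix ([minor_perm]).

    The equality of the two minors says that the fixed points of w, which are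
    the rows and columns by which they differ, split the triangular matrix into
    diagonal blocks ([det_principal_fixed]). The equality of the determinant of
    the h_r(p) with the first minor is Jacobi's identity for complementary
    minors: multiply by the inverse K of Z(c), so that the rows outside F become
    rows of a permutation matrix ([det_principal_jacobi]). That h_r(p) is, up to
    sign, an entry of K is the same identity for a permutation with a single
    excedance ([minor_interval_adj]). The signs match since the sign of w is the
    parity of the sum of w(i) - i over F ([odd_perm_321]).

    For the first equality, specialize c_r(k) to e_r(x_1, ..., x_k). A minor of
    Z(c) is an integer combination of products with exactly one c_r(k) for each
    k, and such products specialize to the basis in which Schubert polynomials
    are expanded. Since these products of elementary symmetric polynomials are
    linearly independent ([elem_independent]), it is enough that the specialized
    determinant is the Schubert polynomial of w ([universal_schubert_span]).
    Independence comes from the kernel prod_{i < k} (x_i - y_k), evaluated at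
    permutations u and v of N points: it vanishes unless u = v, and it factors
    through the products in question.

    The specialized determinant is det (h_{g_i - f_j}(x_1, ..., x_{f_j})), the
    flagged form of the Schubert polynomial of a 321-avoiding permutation
    ([schubert_321]). Its divided differences follow the recursion of Schubert
    polynomials: column j is symmetric in all the variables it involves, and the
    divided difference at f_j changes it to h_{g_i - f_j - 1}(x_1, ...,
    x_{f_j + 1}), which is the column of w s_{f_j}, repeats the next column, or
    can be replaced by a unit column. By induction on the length, all divided
    differences of the two sides agree; so the difference of the two sides is a
    symmetric polynomial. It does not involve the last variable and has no
    constant term, hence it is zero. On the side of Schubert polynomials this
    uses that their recursion holds at every ascent ([schubert_ascent], from the
    braid and commutation relations of divided differences), that they are
    homogeneous with exponents below the staircase ([schubert_staircase]), and
    that the Schubert polynomial of the identity is 1 ([schubert1]), obtained by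
    descending through dominant permutations. *)

(** * Permutations: codes and adjacent transpositions *)

(** The Lehmer code of w at i: the number of inversions with left end i. *)
Definition code (N : nat) (w : 'S_N) (i : 'I_N) : nat :=
  #|[set j : 'I_N | (i < j)%N && (w j < w i)%N]|.

(** The number of inversions, that is, the length of w. *)
Definition ninv (N : nat) (w : 'S_N) : nat := (\sum_i code w i)%N.

Lemma val_tperm (N : nat) (i j a : 'I_N) :
  tperm i j a = (if a == i :> nat then j else if a == j :> nat then i else a) :> nat.
Proof. by rewrite !val_eqE permE /=; case: ifP => // _; case: ifP. Qed.

Lemma tperm_adj_lt (N : nat) (i j a b : 'I_N) : j = i.+1 :> nat ->
  (a, b) != (i, j) -> (a < b)%N -> (tperm i j a < tperm i j b)%N.
Proof.
move=> ij; rewrite xpair_eqE -!val_eqE /= !val_tperm ij.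
by do ![case: eqP => ? //=]; lia.
Qed.

Lemma code_adj_other (N : nat) (w : 'S_N) (i j k : 'I_N) : j = i.+1 :> nat ->
  k != i -> k != j -> code (tperm i j * w)%g k = code w k.
Proof.
move=> ij ki kj; rewrite /code -(card_imset _ (@perm_inj _ (tperm i j))).
apply: eq_card => l; apply/imsetP/idP => [[m]|]; rewrite !inE ?permM.
  move=> /andP[km wm] ->; rewrite (@tpermD _ i j k) in wm; try by rewrite eq_sym.
  rewrite wm andbT -{1}[k](@tpermD _ i j k); try by rewrite eq_sym.
  by apply: tperm_adj_lt => //; apply: contraNneq ki => -[-> _].
move=> /andP[kl wl]; exists (tperm i j l); rewrite ?tpermK // !inE !permM tpermK.
rewrite (@tpermD _ i j k) ?wl ?andbT; try by rewrite eq_sym.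
rewrite -{1}[k](@tpermD _ i j k); try by rewrite eq_sym.
by apply: tperm_adj_lt => //; apply: contraNneq ki => -[-> _].
Qed.

Lemma code_adj_right (N : nat) (w : 'S_N) (i j : 'I_N) : j = i.+1 :> nat ->
  (w i < w j)%N -> code (tperm i j * w)%g j = code w i.
Proof.
move=> ij wij; apply: eq_card => l; rewrite !inE !permM tpermR.
case: (tpermP i j l) => [->|->|/eqP li /eqP lj]; rewrite ?ltnn ?andbF //.
- by rewrite ij ltnNge leqnSn.
- by rewrite [(w j < _)%N]ltnNge (ltnW wij) andbF.
- congr andb; move: li lj; rewrite -!val_eqE /=; lia.
Qed.

Lemma code_adj_left (N : nat) (w : 'S_N) (i j : 'I_N) : j = i.+1 :> nat ->
  (w i < w j)%N -> code (tperm i j * w)%g i = (code w j).+1.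
Proof.
move=> ij wij; rewrite /code (cardsD1 j) !inE !permM tpermR tpermL ij ltnSn wij /=.
rewrite add1n; congr _.+1; apply: eq_card => l; rewrite !inE !permM.
case: (tpermP i j l) => [->|->|/eqP li /eqP lj]; rewrite ?ltnn ?andbF ?eqxx //.
  by rewrite [(i.+1 < _)%N]ltnNge leqnSn.
by rewrite andbA; congr andb; move: li lj; rewrite -!val_eqE /=; lia.
Qed.

Lemma ninv_adj (N : nat) (w : 'S_N) (i j : 'I_N) : j = i.+1 :> nat ->
  (w i < w j)%N -> ninv (tperm i j * w)%g = (ninv w).+1.
Proof.
move=> ij wij; have ji : j != i by rewrite -val_eqE /= ij; lia.
rewrite /ninv (bigD1 i) //= (bigD1 j) //= [in RHS](bigD1 i) //= [in RHS](bigD1 j) //=.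
rewrite code_adj_left // code_adj_right // (eq_bigr (code w)); first by lia.
by move=> k /andP[ki kj]; rewrite code_adj_other.
Qed.

Lemma card_ord_gt (N : nat) (i : 'I_N) : #|[set j : 'I_N | (i < j)%N]| = (N - i.+1)%N.
Proof.
rewrite -sum1_card (eq_bigl (fun j : 'I_N => predT j && (i < j)%N)) => [|j].
  by rewrite -(big_geq_mkord i.+1 N (fun=> true) (fun=> 1%N)) sum_nat_const_nat muln1.
by rewrite inE.
Qed.

Lemma code_le (N : nat) (w : 'S_N) (i : 'I_N) : (code w i <= N - i.+1)%N.
Proof.
rewrite -card_ord_gt; apply/subset_leq_card/subsetP=> j.
by rewrite !inE => /andP[].
Qed.

Lemma sum_rev_ord (N : nat) : (\sum_(i < N) (N - i.+1) = 'C(N, 2))%N.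
Proof.
rewrite -bin2_sum big_mkord (reindex_inj rev_ord_inj).
by apply: eq_bigr => i _ /=; have := ltn_ord i; lia.
Qed.

Lemma ninv_le (N : nat) (w : 'S_N) : (ninv w <= 'C(N, 2))%N.
Proof. by rewrite -sum_rev_ord; apply: leq_sum => i _; apply: code_le. Qed.

Lemma adj_increasing (N : nat) (w : 'S_N) :
  (forall i j : 'I_N, j = i.+1 :> nat -> (w i < w j)%N) ->
  forall i j : 'I_N, (i < j)%N -> (w i < w j)%N.
Proof.
move=> H i j; have [n] := ubnP (j - i)%N; elim: n j => // n IH j le ij.
have lt : (j.-1 < N)%N by have := ltn_ord j; lia.
pose j' := Ordinal lt; have ej : j = j'.+1 :> nat by rewrite /=; lia.
have := H _ _ ej; have [->//|ne] := eqVneq i j'.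
by apply: ltn_trans; apply: IH => //=; move: ne; rewrite -val_eqE /=; lia.
Qed.

Lemma adj_decreasing (N : nat) (w : 'S_N) :
  (forall i j : 'I_N, j = i.+1 :> nat -> (w j < w i)%N) ->
  forall i j : 'I_N, (i < j)%N -> (w j < w i)%N.
Proof.
move=> H i j; have [n] := ubnP (j - i)%N; elim: n j => // n IH j le ij.
have lt : (j.-1 < N)%N by have := ltn_ord j; lia.
pose j' := Ordinal lt; have ej : j = j'.+1 :> nat by rewrite /=; lia.
have := H _ _ ej; have [->//|ne] := eqVneq i j' => h.
by apply: (ltn_trans h); apply: IH => //=; move: ne; rewrite -val_eqE /=; lia.
Qed.

Lemma perm_ge_id (N : nat) (s : 'S_N) : (forall k : 'I_N, (k <= s k)%N) -> s = 1%g.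
Proof.
move=> H; apply/permP=> k; rewrite perm1.
have [n] := ubnP (N - k); elim: n k => // n IH k le.
have := H k; rewrite leq_eqVlt => /orP[/eqP/val_inj //|lt].
have E : s (s k) = s k by apply: IH; have := ltn_ord (s k); lia.
by move: lt; rewrite {1}(perm_inj E) ltnn.
Qed.

Lemma increasing_perm1 (N : nat) (w : 'S_N) :
  (forall i j : 'I_N, (i < j)%N -> (w i < w j)%N) -> w = 1%g.
Proof.
move=> H; apply: perm_ge_id => -[j lj] /=; elim: j lj => // j IH lj.
have lj' : (j < N)%N by lia.
by apply: leq_ltn_trans (IH lj') _; apply: H => /=.
Qed.

Lemma code_no_ascent (N : nat) (w : 'S_N) :
  (forall i j : 'I_N, j = i.+1 :> nat -> (w j < w i)%N) ->
  forall i, code w i = (N - i.+1)%N.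
Proof.
move=> H i; rewrite -card_ord_gt; apply: eq_card => j; rewrite !inE.
by case: ltnP => //= ij; apply: adj_decreasing.
Qed.

Lemma adj_cases (N : nat) (w : 'S_N) (i j : 'I_N) : j = i.+1 :> nat ->
  (w i < w j)%N || (w j < w i)%N.
Proof.
move=> ij; case: ltngtP => // /val_inj/perm_inj E.
by move: ij; rewrite E; lia.
Qed.

Lemma ascent_or_decreasing (N : nat) (w : 'S_N) :
  (exists i j : 'I_N, j = i.+1 :> nat /\ (w i < w j)%N)
  \/ (forall i j : 'I_N, j = i.+1 :> nat -> (w j < w i)%N).
Proof.
have [/existsP[i /existsP[j /andP[/eqP ij wij]]]|nE] :=
  boolP [exists i : 'I_N, exists j : 'I_N, (j == i.+1 :> nat) && (w i < w j)%N].
  by left; exists i, j.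
right=> i j ij; have /orP[lt|//] := adj_cases w ij; case/negP: nE.
by apply/existsP; exists i; apply/existsP; exists j; rewrite ij eqxx.
Qed.

Lemma exists_descent (N : nat) (w : 'S_N) : w != 1%g ->
  exists i : 'I_N, exists2 j : 'I_N, j = i.+1 :> nat & (w j < w i)%N.
Proof.
move=> w1; have [/existsP[i /existsP[j /andP[/eqP ij]]]|nE] :=
  boolP [exists i : 'I_N, exists j : 'I_N, (j == i.+1 :> nat) && (w j < w i)%N].
  by exists i; exists j.
case/eqP: w1; apply/increasing_perm1/adj_increasing => i j ij.
have /orP[//|lt] := adj_cases w ij.
case/negP: nE; apply/existsP; exists i; apply/existsP; exists j.
by rewrite ij eqxx.
Qed.

(** Induction on the length: P passes to w from the permutations obtained by
    swapping the values at one of its descents. *)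
Lemma perm_descent_ind (N : nat) (P : 'S_N -> Prop) :
  P 1%g ->
  (forall (w : 'S_N) (i j : 'I_N), j = i.+1 :> nat -> (w j < w i)%N ->
     (forall k l : 'I_N, l = k.+1 :> nat -> (w l < w k)%N -> P (tperm k l * w)%g) ->
     P w) ->
  forall w, P w.
Proof.
move=> P1 Ps w; have [n] := ubnP (ninv w); elim: n w => // n IH w le.
have [->//|/exists_descent[i [j ij wij]]] := eqVneq w 1%g.
apply: (Ps _ _ _ ij wij) => {ij wij} {i j} i j ij wij; apply: IH.
have := ninv_adj (w := (tperm i j * w)%g) ij.
rewrite !permM tpermL tpermR mulgA tperm2 mul1g.
by move=> /(_ wij); lia.
Qed.

Lemma tperm_braid (N : nat) (i j k : 'I_N) : uniq [:: i; j; k] ->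
  (tperm i j * (tperm j k * tperm i j) = tperm j k * (tperm i j * tperm j k))%g.
Proof.
rewrite /= !inE !negb_or => /and3P[/andP[ij ik] jk _].
have := tpermJ i j (tperm j k); have := tpermJ j k (tperm i j).
by rewrite /conjg !tpermV tpermL tpermR !tpermD // 1?eq_sym // => <-.
Qed.

Lemma tperm_comm (N : nat) (i j k l : 'I_N) : uniq [:: i; j; k; l] ->
  (tperm i j * tperm k l = tperm k l * tperm i j)%g.
Proof.
rewrite /= !inE !negb_or => /and4P[/and3P[ij ik il] /andP[jk jl] kl _].
by apply/commgP/conjg_fixP; rewrite tpermJ !tpermD // eq_sym.
Qed.


(** * 321-avoiding permutations *)

Lemma card_ord_lt (N : nat) (i : 'I_N) : #|[set j : 'I_N | (j < i)%N]| = i.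
Proof.
rewrite -sum1_card (eq_bigl (fun j : 'I_N => (j < i)%N)) => [|j]; last by rewrite inE.
by rewrite (big_ord_narrow (ltnW (ltn_ord i))) sum1_card card_ord.
Qed.

Lemma card_perm_lt (N : nat) (w : 'S_N) (i : 'I_N) :
  #|[set j : 'I_N | (w j < i)%N]| = i.
Proof.
rewrite -[RHS]card_ord_lt -(card_imset _ (@perm_inj _ w)).
apply: eq_card => j; rewrite inE; apply/imsetP/idP => [[k]|ji].
  by rewrite inE => ? ->.
by exists ((w^-1)%g j); rewrite ?inE permKV.
Qed.

(** For an excedance j, fewer than w(j) positions precede j, so a value below w(j)
    occurs after j; together with a larger value before j it would form 321. *)
Lemma exc_gt (N : nat) (w : 'S_N) (i j : 'I_N) :
  avoids_321 w -> j \in exc w -> (i < j)%N -> (w i < w j)%N.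
Proof.
rewrite inE => hw jw ij.
case: (ltngtP (w i) (w j)) => // [wij|/val_inj/perm_inj E]; last first.
  by rewrite E ltnn in ij.
have : ~~ ([set k : 'I_N | (w k < w j)%N] \subset [set k : 'I_N | (k < j)%N]).
  by apply/negP=> /subset_leq_card; rewrite card_perm_lt card_ord_lt leqNgt jw.
case/subsetPn=> k; rewrite !inE -leqNgt [(j <= k)%N]leq_eqVlt.
move=> wkj /orP[/eqP/val_inj E|jk].
  by rewrite E ltnn in wkj.
by case: (hw _ _ _ ij jk).
Qed.

(** The mirror image of [exc_gt]: a smaller value after a non-excedance i forces a
    value above w(i) before i. *)
Lemma nonexc_lt (N : nat) (w : 'S_N) (i j : 'I_N) :
  avoids_321 w -> i \notin exc w -> (i < j)%N -> (w i < w j)%N.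
Proof.
rewrite inE -leqNgt => hw iw ij.
case: (ltngtP (w i) (w j)) => // [wij|/val_inj/perm_inj E]; last first.
  by rewrite E ltnn in ij.
have : ~~ (j |: [set k : 'I_N | (k < i)%N] \subset [set k : 'I_N | (w k < w i)%N]).
  apply/negP=> /subset_leq_card; rewrite cardsU1 card_perm_lt card_ord_lt inE.
  by rewrite ltnNge (ltnW ij) add1n ltnNge iw.
case/subsetPn=> k; rewrite !inE -leqNgt => /orP[/eqP->|ki]; first by rewrite leqNgt wij.
rewrite leq_eqVlt => /orP[/eqP/val_inj/perm_inj E|wik]; first by rewrite E ltnn in ki.
by case: (hw _ _ _ ki ij).
Qed.

Lemma fixed_lt (N : nat) (w : 'S_N) (i k : 'I_N) :
  avoids_321 w -> w k = k -> (i < k)%N -> (w i < k)%N.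
Proof.
move=> hw wk ik.
have E : [set j : 'I_N | (w j < k)%N] = [set j : 'I_N | (j < k)%N].
  apply/eqP; rewrite eqEcard card_perm_lt card_ord_lt leqnn andbT.
  apply/subsetP=> j; rewrite !inE; case: (ltngtP j k) => // [kj|/val_inj->].
    by have := nonexc_lt (i := k) hw _ kj; rewrite inE wk ltnn => /(_ isT); lia.
  by rewrite wk ltnn.
by have := ik; move/setP/(_ i): E; rewrite !inE => ->.
Qed.

(** A descent of a 321-avoiding permutation goes from an excedance down to an
    anti-excedance. *)
Lemma descent_exc (N : nat) (w : 'S_N) (i j : 'I_N) : avoids_321 w ->
  j = i.+1 :> nat -> (w j < w i)%N ->
  [/\ i \in exc w, j \notin exc w & (w j <= i)%N].
Proof.
move=> hw ij wij; have lij : (i < j)%N by rewrite ij.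
have iw : i \in exc w.
  by apply: contraLR wij => /(nonexc_lt hw)/(_ lij); rewrite -leqNgt => /ltnW.
have jw : j \notin exc w.
  by apply: contraL wij => /(exc_gt hw)/(_ lij); rewrite -leqNgt => /ltnW.
split=> //; move: jw; rewrite inE -leqNgt leq_eqVlt ij ltnS => /orP[/eqP E|//].
have wj : w j = j by apply: val_inj; rewrite /= E ij.
by have := fixed_lt hw wj lij; rewrite -{1}wj; lia.
Qed.

Lemma avoids_321_descent (N : nat) (w : 'S_N) (i j : 'I_N) : avoids_321 w ->
  j = i.+1 :> nat -> (w j < w i)%N -> avoids_321 (tperm i j * w)%g.
Proof.
move=> hw ij wij a b c ab bc; rewrite !permM => -[wcb wba].
have lt (x y : 'I_N) : (x < y)%N -> (w (tperm i j y) < w (tperm i j x))%N ->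
    (tperm i j x < tperm i j y)%N.
  move=> xy wyx; apply: tperm_adj_lt => //; apply: contraTneq wyx => -[-> ->].
  by rewrite tpermL tpermR -leqNgt ltnW.
exact: hw (lt _ _ ab wba) (lt _ _ bc wcb) (conj wcb wba).
Qed.

(** Swapping a descent i, i + 1 moves the excedance i to i + 1, or removes it when
    w(i) = i + 1. *)
Lemma exc_descent (N : nat) (w : 'S_N) (i j : 'I_N) : avoids_321 w ->
  j = i.+1 :> nat -> (w j < w i)%N ->
  exc (tperm i j * w)%g = if (w i == j) then exc w :\ i else j |: (exc w :\ i).
Proof.
move=> hw ij wij; have [iw jw wj] := descent_exc hw ij wij.
have ji : (j != i) by rewrite -val_eqE /= ij; lia.
apply/setP=> k; rewrite inE permM; case: tpermP => [->|->|/eqP ki /eqP kj].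
- by rewrite ltnNge wj; case: ifP => _; rewrite !inE eqxx //= eq_sym (negbTE ji).
- rewrite inE in iw; have {}iw : (j <= w i)%N by rewrite ij.
  case: ifP => [/eqP->|/negbT ne].
    by rewrite ltnn !inE ji /= ltnNge; move: jw; rewrite inE -leqNgt => ->.
  by rewrite !inE eqxx /= ltn_neqAle iw andbT eq_sym.
by case: ifP; rewrite !inE ki ?(negbTE kj).
Qed.

Lemma code_321 (N : nat) (w : 'S_N) (i : 'I_N) : avoids_321 w ->
  code w i = (w i - i)%N.
Proof.
move=> hw; have [iw|iw] := boolP (i \in exc w); last first.
  have : (w i <= i)%N by move: iw; rewrite inE -leqNgt.
  rewrite -subn_eq0 => /eqP->; apply: eq_card0 => j; rewrite !inE.
  by case: ltnP => //= /(nonexc_lt hw iw) h; apply/negbTE; rewrite -leqNgt ltnW.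
rewrite -[X in (X - _)%N](card_perm_lt w (w i)) -(card_ord_lt i) -cardsDS.
  apply: eq_card => j; rewrite !inE -leqNgt [(i <= j)%N]leq_eqVlt.
  by case: eqP => [/val_inj->|_] //=; rewrite !ltnn andbF.
by apply/subsetP=> j; rewrite !inE; apply: exc_gt.
Qed.

Lemma odd_perm_ninv (N : nat) (w : 'S_N) : odd_perm w = odd (ninv w).
Proof.
elim/perm_descent_ind: w => [|w i j ij wij /(_ i j ij wij) IH].
  rewrite odd_perm1 /ninv big1 // => i _; apply: eq_card0 => j; rewrite !inE !perm1; lia.
have E : (tperm i j * (tperm i j * w))%g = w by rewrite mulgA tperm2 mul1g.
have := ninv_adj (w := (tperm i j * w)%g) ij; rewrite E !permM tpermL tpermR => -> //.
rewrite -{1}E odd_permM IH odd_tperm.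
by have -> : i != j by rewrite -val_eqE /= ij; lia.
Qed.

Lemma odd_perm_321 (N : nat) (w : 'S_N) : avoids_321 w ->
  odd_perm w = odd (\sum_(i in exc w) (w i - i)).
Proof.
move=> hw; rewrite odd_perm_ninv /ninv; congr odd.
rewrite [LHS](bigID (mem (exc w))) /= addnC big1 => [|i].
  by apply: eq_bigr => i _; rewrite code_321.
by rewrite inE -leqNgt code_321 // => h; apply/eqP; rewrite subn_eq0.
Qed.

Local Open Scope ring_scope.

(** * Determinants, minors and zero blocks *)

(** Sylvester's determinant identity. *)
Lemma det_add1_mulC (R : comNzRingType) (m n : nat) (X : 'M[R]_(m, n))
    (Y : 'M[R]_(n, m)) :
  \det (1%:M + X *m Y) = \det (1%:M + Y *m X).
Proof.
have E1 : block_mx 1%:M (- X) Y 1%:M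
    = block_mx 1%:M 0 Y 1%:M *m block_mx 1%:M (- X) 0 (1%:M + Y *m X).
  rewrite mulmx_block !mul1mx !mul0mx ?mulmx0 !mulmx1 !addr0.
  by rewrite mulmxN addrC addrK.
have E2 : block_mx 1%:M (- X) Y 1%:M
    = block_mx (1%:M + X *m Y) (- X) 0 1%:M *m block_mx 1%:M 0 Y 1%:M.
  rewrite mulmx_block ?mul1mx ?mul0mx ?mulmx0 ?mulmx1 ?add0r.
  by rewrite mulNmx addrK.
have := congr1 determinant E1; rewrite {1}E2 !det_mulmx !det_ublock !det_lblock.
by rewrite !det1 !mulr1 !mul1r.
Qed.

(** The N x N matrix whose determinant is the principal minor of B on S: the rows
    outside S are replaced by unit rows. *)
Definition principal_mx (R : nzRingType) (N : nat) (S : {set 'I_N})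
    (B : 'M[R]_N) : 'M[R]_N :=
  \matrix_(i, j) if i \in S then B i j else (i == j)%:R.

Lemma det_principal (R : comNzRingType) (N r : nat) (f : 'I_r -> 'I_N)
    (S : {set 'I_N}) (B : 'M[R]_N) :
  injective f -> S = f @: setT ->
  \det (principal_mx S B) = \det (\matrix_(i, j) B (f i) (f j)).
Proof.
move=> finj ->.
pose X : 'M[R]_(N, r) := \matrix_(i, a) (i == f a)%:R.
pose Y : 'M[R]_(r, N) := \matrix_(a, j) (B (f a) j - (f a == j)%:R).
have -> : principal_mx (f @: setT) B = 1%:M + X *m Y.
  apply/matrixP=> i j; rewrite !mxE; case: ifP => [/imsetP[a _ ->]|nS].
    rewrite (bigD1 a) //= big1 => [|b ba]; last first.
      by rewrite !mxE (inj_eq finj) eq_sym (negbTE ba) mul0r.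
    by rewrite !mxE eqxx mul1r addr0 addrC subrK.
  rewrite big1 ?addr0 // => a _; rewrite !mxE; case: eqP => [ia|]; last by rewrite mul0r.
  by rewrite ia imset_f // inE in nS.
rewrite det_add1_mulC; congr (\det _); apply/matrixP=> a b.
rewrite !mxE (bigD1 (f b)) //= big1 => [|j jb]; last by rewrite !mxE (negbTE jb) mulr0.
by rewrite !mxE eqxx mulr1 addr0 (inj_eq finj) addrC subrK.
Qed.

(** A permutation cannot avoid a zero block I x J with #|I| + #|J| > N. *)
Lemma prod_zero_block (R : comNzRingType) (N : nat) (A : 'M[R]_N) (s : 'S_N)
    (I J : {set 'I_N}) :
  (forall i j, i \in I -> j \in J -> A i j = 0) -> (N < #|I| + #|J|)%N ->
  \prod_i A i (s i) = 0.
Proof.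
move=> A0 IJ.
have /exists_inP[i iI siJ] : [exists i in I, s i \in J].
  apply: contraLR IJ => /exists_inPn nJ; rewrite -leqNgt.
  rewrite -(card_imset (mem I) (@perm_inj _ s)) -[leqRHS]card_ord -(cardsC J).
  rewrite addnC leq_add2l subset_leq_card //.
  by apply/subsetP=> _ /imsetP[i iI ->]; rewrite inE nJ.
by rewrite (bigD1 i) //= A0 // mul0r.
Qed.

Lemma det_zero_block (R : comNzRingType) (N : nat) (A : 'M[R]_N)
    (I J : {set 'I_N}) :
  (forall i j, i \in I -> j \in J -> A i j = 0) -> (N < #|I| + #|J|)%N ->
  \det A = 0.
Proof.
by move=> A0 IJ; apply: big1 => s _; rewrite (prod_zero_block _ A0 IJ) mulr0.
Qed.

Lemma enum_val_incr (N r : nat) (f : 'I_r -> 'I_N) (I : {set 'I_N}) :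
  (forall a b : 'I_r, (a < b)%N -> (f a < f b)%N) -> I = f @: setT ->
  exists e : #|I| = r, forall a : 'I_#|I|, enum_val a = f (cast_ord e a).
Proof.
move=> finc EI.
have finj : injective f.
  move=> a b fab; apply/val_inj/eqP; rewrite eqn_leq; apply/andP; split;
  by rewrite leqNgt; apply/negP=> /finc; rewrite fab ltnn.
have e : #|I| = r by rewrite EI card_imset // cardsT card_ord.
have lt_tr : transitive (fun i j : 'I_N => i < j)%N by move=> y x z; apply: ltn_trans.
have lt_irr : irreflexive (fun i j : 'I_N => i < j)%N by move=> x; apply: ltnn.
have E : enum I = [seq f a | a <- enum 'I_r].
  apply: (irr_sorted_eq lt_tr lt_irr).
  - rewrite {1}/enum_mem -enumT; apply: sorted_filter => //.
    rewrite -(@sorted_map _ _ val ltn) val_enum_ord.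
    exact: iota_ltn_sorted.
  - apply: (@homo_sorted _ _ f (fun i j : 'I_r => i < j)%N) => //.
    rewrite -(@sorted_map _ _ val ltn) val_enum_ord; exact: iota_ltn_sorted.
  - move=> i; rewrite mem_enum EI; apply/imsetP/mapP => [[a _ ->]|[a _ ->]];
    by exists a; rewrite ?mem_enum.
exists e => a; rewrite /enum_val (set_nth_default (f (cast_ord e a))) -?cardE //.
rewrite E (nth_map (cast_ord e a)) ?size_enum_ord -?e //.
by congr f; apply: val_inj; rewrite /= nth_enum_ord // -e.
Qed.

Lemma minor_incr (R : comNzRingType) (N r : nat) (A : 'M[R]_N)
    (f g : 'I_r -> 'I_N) (I J : {set 'I_N}) :
  (forall a b : 'I_r, (a < b)%N -> (f a < f b)%N) ->
  (forall a b : 'I_r, (a < b)%N -> (g a < g b)%N) ->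
  I = f @: setT -> J = g @: setT ->
  minor A I J = \det (\matrix_(a, b) A (f a) (g b)).
Proof.
move=> finc ginc EI EJ.
have [eI fE] := enum_val_incr finc EI; have [eJ gE] := enum_val_incr ginc EJ.
rewrite /minor; under eq_mx => a b do rewrite fE gE.
move: (#|I|) (#|J|) eI eJ {fE gE} => m n em en; subst m n.
rewrite conform_mx_id; congr (\det _); apply/matrixP=> a b; rewrite !mxE.
by rewrite !cast_ord_id.
Qed.

(** Jacobi's identity for complementary minors of inverse matrices Z and K.
    Multiplying on the right by K turns the rows i in S into the rows of the
    permutation matrix of w, and the unit rows into rows of K; permuting the
    columns by w then gives the complementary principal minor. *)
Lemma det_principal_jacobi (R : comNzRingType) (N : nat) (Z K : 'M[R]_N)
    (w : 'S_N) (S : {set 'I_N}) :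
  Z *m K = 1%:M -> \det K = 1 ->
  \det (principal_mx S (row_perm w Z))
  = (-1) ^+ odd_perm w * \det (principal_mx (~: S) (col_perm w K)).
Proof.
move=> ZK dK.
have -> : \det (principal_mx S (row_perm w Z))
    = \det (principal_mx S (row_perm w Z) *m K) by rewrite det_mulmx dK mulr1.
have -> : principal_mx (~: S) (col_perm w K)
    = col_perm w (principal_mx S (row_perm w Z) *m K).
  apply/matrixP=> i j; rewrite !mxE inE; case: ifP => iS.
    rewrite (bigD1 i) //= big1 => [|k ki].
      by rewrite !mxE (negbTE iS) eqxx mul1r addr0.
    by rewrite !mxE (negbTE iS) eq_sym (negbTE ki) mul0r.
  have /matrixP/(_ (w i) (w j)) := ZK; rewrite !mxE (inj_eq perm_inj) => <-.
  by apply: eq_bigr => k _; rewrite !mxE (negbFE iS).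
rewrite [in RHS]col_permE [in RHS]det_mulmx det_perm mulrCA -signr_addb.
by rewrite odd_permV addbb mulr1.
Qed.

(** * Divided differences *)

(** g is the divided difference of f, for the substitution s and the linear form
    x. The algebra of divided differences is carried out in an abstract integral
    domain. *)
Definition is_divdiff (R : idomainType) (s : R -> R) (x f g : R) : Prop :=
  x * g = f - s f.

Lemma is_divdiffD (R : idomainType) (s : {rmorphism R -> R}) (x f g f' g' : R) :
  is_divdiff s x f g -> is_divdiff s x f' g' ->
  is_divdiff s x (f + f') (g + g').
Proof. by rewrite /is_divdiff mulrDr rmorphD => -> ->; ring. Qed.

Lemma is_divdiffN (R : idomainType) (s : {rmorphism R -> R}) (x f g : R) :
  is_divdiff s x f g -> is_divdiff s x (- f) (- g).
Proof. by rewrite /is_divdiff mulrN rmorphN => ->; ring. Qed.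

Lemma is_divdiffM (R : idomainType) (s : {rmorphism R -> R}) (x a f g : R) :
  s a = a -> is_divdiff s x f g -> is_divdiff s x (a * f) (a * g).
Proof. by rewrite /is_divdiff mulrCA rmorphM => -> ->; ring. Qed.

Lemma is_divdiff_inv (R : idomainType) (s : {rmorphism R -> R}) (x f g : R) :
  x != 0 -> s x = - x -> involutive s -> is_divdiff s x f g -> s g = g.
Proof.
rewrite /is_divdiff => x0 sx ss E; apply: (mulfI x0); rewrite E.
have := congr1 s E; rewrite rmorphM rmorphB /= sx ss mulNr => /eqP.
by rewrite eqr_oppLR opprB => /eqP.
Qed.

Lemma is_divdiffC (R : idomainType) (s t : {rmorphism R -> R}) (x y f a b c d : R) :
  x != 0 -> y != 0 -> s y = y -> t x = x -> s (t f) = t (s f) ->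
  is_divdiff s x f a -> is_divdiff t y f b ->
  is_divdiff s x b c -> is_divdiff t y a d -> c = d.
Proof.
rewrite /is_divdiff => x0 y0 sy tx st Ea Eb Ec Ed.
apply: (mulfI x0); apply: (mulfI y0).
have Esb : y * s b = s f - s (t f) by rewrite -[in LHS]sy -rmorphM Eb rmorphB.
have Eta : x * t a = t f - t (s f) by rewrite -[in LHS]tx -rmorphM Ea rmorphB.
by rewrite Ec mulrBr Eb Esb [RHS]mulrCA Ed mulrBr Ea Eta st; ring.
Qed.

(** The product of the three linear forms with a triple divided difference is
    the antisymmetrization over the six permutations of three variables. *)
Lemma is_divdiff3 (R : idomainType) (s t : {rmorphism R -> R})
    (a b c f g h u : R) :
  a != b -> involutive s -> s a = b -> s b = a -> s c = c ->
  t a = a -> t b = c -> t c = b ->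
  is_divdiff s (a - b) f g -> is_divdiff t (b - c) g h ->
  is_divdiff s (a - b) h u ->
  (a - b) * (b - c) * (a - c) * u
  = f - s f - t f + t (s f) + s (t f) - s (t (s f)).
Proof.
rewrite /is_divdiff -subr_eq0 => ab ss sa sb sc ta tb tc Eg Eh Eu; apply: (mulfI ab).
have Etg := congr1 t Eg; rewrite rmorphM !rmorphB /= ta tb in Etg.
have E6 : (a - b) * (a - c) * (b - c) * h
    = (a - c) * (f - s f) - (a - b) * (t f - t (s f)).
  by rewrite -mulrA Eh -Eg -Etg; ring.
have Es := congr1 s E6; rewrite !(rmorphM, rmorphB) /= sa sb sc !ss in Es.
have -> : (a - b) * ((a - b) * (b - c) * (a - c) * u)
  = (a - b) * (a - c) * (b - c) * ((a - b) * u) by ring.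
rewrite Eu mulrBr E6.
have -> : (a - b) * (a - c) * (b - c) * s h
  = - ((b - a) * (b - c) * (a - c) * s h) by ring.
by rewrite Es; ring.
Qed.

Lemma is_divdiff_braid (R : idomainType) (s t : {rmorphism R -> R})
    (a b c f g h u g' h' u' : R) :
  a != b -> b != c -> a != c -> involutive s -> involutive t ->
  s a = b -> s b = a -> s c = c -> t a = a -> t b = c -> t c = b ->
  s (t (s f)) = t (s (t f)) ->
  is_divdiff s (a - b) f g -> is_divdiff t (b - c) g h ->
  is_divdiff s (a - b) h u ->
  is_divdiff t (b - c) f g' -> is_divdiff s (a - b) g' h' ->
  is_divdiff t (b - c) h' u' -> u = u'.
Proof.
move=> ab bc ac ss tt sa sb sc ta tb tc sts E1 E2 E3 E1' E2' E3'.
have V0 : (a - b) * (b - c) * (a - c) != 0 by rewrite !mulf_neq0 // subr_eq0.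
apply: (mulfI V0); rewrite (is_divdiff3 ab ss sa sb sc ta tb tc E1 E2 E3).
have cb : c != b by rewrite eq_sym.
have flip (r : {rmorphism R -> R}) x y p q :
    is_divdiff r (x - y) p q -> is_divdiff r (y - x) p (- q).
  by rewrite /is_divdiff mulrN -mulNr opprB.
have {}E1' := flip _ _ _ _ _ E1'.
have {}E2' := is_divdiffN (flip _ _ _ _ _ E2'); rewrite opprK in E2'.
have {}E3' := flip _ _ _ _ _ E3'.
have -> : (a - b) * (b - c) * (a - c) * u' = (c - b) * (b - a) * (c - a) * - u' by ring.
by rewrite (is_divdiff3 cb tt tc tb ta sc sb sa E1' E2' E3') sts; ring.
Qed.

Lemma msymXi (N : nat) (s : 'S_N) (k : 'I_N) :
  msym s 'X_k = 'X_(s k) :> {mpoly int[N]}.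
Proof.
rewrite msymX; congr 'X_[_]; apply/mnmP=> l; rewrite !mnmE.
by rewrite -(inj_eq (@perm_inj _ s)) permKV.
Qed.

Lemma subX_neq0 (N : nat) (i j : 'I_N) : i != j ->
  'X_i - 'X_j != 0 :> {mpoly int[N]}.
Proof.
move=> ij; apply/eqP=> /(congr1 (mcoeff U_(i)%MM)).
by rewrite mcoeffB !mcoeffXU eqxx eq_sym (negbTE ij) mcoeff0.
Qed.

Lemma divdiffE (N : nat) (i j : 'I_N) (f : {mpoly int[N]}) :
  ('X_i - 'X_j) * divdiff i j f = f - msym (tperm i j) f.
Proof. exact/eqP/(xchooseP (divdiff_ex i j f)). Qed.

Lemma divdiff_unique (N : nat) (i j : 'I_N) (f g : {mpoly int[N]}) : i != j ->
  ('X_i - 'X_j) * g = f - msym (tperm i j) f -> divdiff i j f = g.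
Proof. by move=> ij; rewrite -divdiffE => /(mulfI (subX_neq0 ij)). Qed.


Lemma is_divdiffP (N : nat) (i j : 'I_N) (f : {mpoly int[N]}) :
  is_divdiff (msym (tperm i j)) ('X_i - 'X_j) f (divdiff i j f).
Proof. exact: divdiffE. Qed.

Lemma msym_tpermK (N : nat) (i j : 'I_N) :
  involutive (msym (tperm i j) : {mpoly int[N]} -> {mpoly int[N]}).
Proof. by move=> f; rewrite -msymMm tperm2 msym1m. Qed.

Lemma divdiffD (N : nat) (i j : 'I_N) (f g : {mpoly int[N]}) : i != j ->
  divdiff i j (f + g) = divdiff i j f + divdiff i j g.
Proof.
move=> ij; apply: divdiff_unique => //.
exact: is_divdiffD (is_divdiffP i j f) (is_divdiffP i j g).
Qed.

Lemma divdiffM_sym (N : nat) (i j : 'I_N) (f g : {mpoly int[N]}) : i != j ->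
  msym (tperm i j) f = f -> divdiff i j (f * g) = f * divdiff i j g.
Proof.
move=> ij sf; apply: divdiff_unique => //.
exact: is_divdiffM sf (is_divdiffP i j g).
Qed.

Lemma divdiff_sym0 (N : nat) (i j : 'I_N) (f : {mpoly int[N]}) : i != j ->
  msym (tperm i j) f = f -> divdiff i j f = 0.
Proof. by move=> ij sf; apply: divdiff_unique; rewrite // sf subrr mulr0. Qed.

Lemma divdiff_eq0 (N : nat) (i j : 'I_N) (f : {mpoly int[N]}) :
  divdiff i j f = 0 -> msym (tperm i j) f = f.
Proof. by move=> f0; apply/esym/eqP; rewrite -subr_eq0 -divdiffE f0 mulr0. Qed.

Lemma divdiffN (N : nat) (i j : 'I_N) (f : {mpoly int[N]}) : i != j ->
  divdiff i j (- f) = - divdiff i j f.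
Proof.
move=> ij; apply: divdiff_unique => //.
exact: is_divdiffN (is_divdiffP i j f).
Qed.

Lemma divdiff_sum (N : nat) (i j : 'I_N) (I : Type) (r : seq I) (P : pred I)
    (F : I -> {mpoly int[N]}) : i != j ->
  divdiff i j (\sum_(k <- r | P k) F k) = \sum_(k <- r | P k) divdiff i j (F k).
Proof.
move=> ij; apply: (big_morph (divdiff i j)) => [f g|]; first exact: divdiffD.
by apply: divdiff_sym0; rewrite ?msym0.
Qed.

Lemma msym_divdiff (N : nat) (i j : 'I_N) (f : {mpoly int[N]}) : i != j ->
  msym (tperm i j) (divdiff i j f) = divdiff i j f.
Proof.
move=> ij; apply: is_divdiff_inv (subX_neq0 ij) _ (msym_tpermK i j) (is_divdiffP i j f).
by rewrite /= msymB !msymXi tpermL tpermR opprB.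
Qed.

Lemma divdiff_msym (N : nat) (i j : 'I_N) (f : {mpoly int[N]}) : i != j ->
  divdiff i j (msym (tperm i j) f) = - divdiff i j f.
Proof.
move=> ij; apply: divdiff_unique => //.
by rewrite mulrN divdiffE msym_tpermK opprB.
Qed.

Lemma divdiffC (N : nat) (i j k l : 'I_N) (f : {mpoly int[N]}) :
  uniq [:: i; j; k; l] ->
  divdiff i j (divdiff k l f) = divdiff k l (divdiff i j f).
Proof.
move=> U; have := U.
rewrite /= !inE !negb_or => /and4P[/and3P[ij ik il] /andP[jk jl] kl _].
have st : msym (tperm i j) (msym (tperm k l) f)
    = msym (tperm k l) (msym (tperm i j) f).
  by rewrite -!msymMm (tperm_comm U).
apply: is_divdiffC (subX_neq0 ij) (subX_neq0 kl) _ _ st (is_divdiffP i j f)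
  (is_divdiffP k l f) (is_divdiffP i j _) (is_divdiffP k l _).
  by rewrite /= msymB !msymXi !tpermD.
by rewrite /= msymB !msymXi !tpermD // eq_sym.
Qed.

Lemma divdiff_braid (N : nat) (i j k : 'I_N) (f : {mpoly int[N]}) :
  uniq [:: i; j; k] ->
  divdiff i j (divdiff j k (divdiff i j f)) = divdiff j k (divdiff i j (divdiff j k f)).
Proof.
move=> U; have := U.
rewrite /= !inE !negb_or => /and3P[/andP[ij ik] jk _].
have X_neq (a b : 'I_N) : a != b -> 'X_a != 'X_b :> {mpoly int[N]}.
  by move=> ab; rewrite -subr_eq0 subX_neq0.
apply: (is_divdiff_braid (X_neq _ _ ij) (X_neq _ _ jk) (X_neq _ _ ik)
  (msym_tpermK i j) (msym_tpermK j k) _ _ _ _ _ _ _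
  (is_divdiffP i j f) (is_divdiffP j k _) (is_divdiffP i j _)
  (is_divdiffP j k f) (is_divdiffP i j _) (is_divdiffP j k _)).
1-6: by rewrite /= msymXi ?tpermL ?tpermR ?tpermD // eq_sym.
by have := congr1 (fun u => msym u f) (tperm_braid U); rewrite !msymMm.
Qed.

(** * Schubert polynomials: recursion, support, normalization *)

Lemma adj_neq (N : nat) (i j : 'I_N) : j = i.+1 :> nat -> i != j.
Proof. by move=> ij; rewrite -val_eqE /= ij; lia. Qed.

Lemma tperm_mulL (N : nat) (w : 'S_N) (i j : 'I_N) : (tperm i j * w)%g i = w j.
Proof. by rewrite permM tpermL. Qed.

Lemma tperm_mulR (N : nat) (w : 'S_N) (i j : 'I_N) : (tperm i j * w)%g j = w i.
Proof. by rewrite permM tpermR. Qed.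

Lemma tperm_mulD (N : nat) (w : 'S_N) (i j k : 'I_N) : i != k -> j != k ->
  (tperm i j * w)%g k = w k.
Proof. by move=> ik jk; rewrite permM tpermD. Qed.

(** Either the recursion takes a step at some ascent, or w is the longest
    permutation and every amount of fuel gives the staircase monomial. *)
Lemma schubert_recS (N l : nat) (w : 'S_N) :
  (exists i j : 'I_N, [/\ j = i.+1 :> nat, (w i < w j)%N &
     schubert_rec l.+1 w = divdiff i j (schubert_rec l (tperm i j * w)%g)])
  \/ (forall i j : 'I_N, j = i.+1 :> nat -> (w j < w i)%N)
     /\ (forall l', schubert_rec l' w = \prod_(i < N) 'X_i ^+ (N - i.+1)).
Proof.
rewrite /=; case: pickP => [[i j] /andP[/eqP /= ij wij]|none].
  by left; exists i, j.
right; split=> [i j ij|].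
  by have := none (i, j); rewrite /= ij eqxx /=; have /orP[->|] := adj_cases w ij.
by case=> //= l'; case: pickP => // ij; rewrite none.
Qed.



(* Unification would otherwise unfold these while comparing polynomials. *)
Local Opaque divdiff schubert_rec ninv.

(** With enough fuel the recursion holds at every ascent (i, j), not only at the
    chosen one (a, b). If the two are disjoint, both sides go two steps up to the
    same permutation by the commutation relation; if they overlap, three steps
    up by the braid relation. *)
Lemma schubert_rec_ascent (N l : nat) (w : 'S_N) (i j : 'I_N) :
  j = i.+1 :> nat -> (w i < w j)%N -> ('C(N, 2) <= l.+1 + ninv w)%N ->
  schubert_rec l.+1 w = divdiff i j (schubert_rec l (tperm i j * w)%g).
Proof.
elim/ltn_ind: l w i j => l IH.
have IH' (w : 'S_N) (i j : 'I_N) m : (m.+1 <= l)%N -> j = i.+1 :> nat ->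
    (w i < w j)%N -> ('C(N, 2) <= m.+1 + ninv w)%N ->
    schubert_rec m.+1 w = divdiff i j (schubert_rec m (tperm i j * w)%g).
  by move=> ml ij wij le; apply: IH.
have triple (w : 'S_N) (i j k : 'I_N) : j = i.+1 :> nat -> k = j.+1 :> nat ->
    (w i < w j)%N -> (w j < w k)%N -> ('C(N, 2) <= l.+1 + ninv w)%N ->
    divdiff i j (schubert_rec l (tperm i j * w)%g)
    = divdiff j k (schubert_rec l (tperm j k * w)%g).
  move=> ij jk wij wjk le; have wik := ltn_trans wij wjk.
  have nij := adj_neq ij; have njk := adj_neq jk.
  have nik : i != k by rewrite -val_eqE /= jk ij; lia.
  have [nji nkj nki] : [/\ j != i, k != j & k != i] by rewrite !(eq_sym _ i) (eq_sym k j).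
  have U : uniq [:: i; j; k] by rewrite /= !inE !negb_or nij nik njk.
  set s := tperm i j; set t := tperm j k.
  have Es : ninv (s * w)%g = (ninv w).+1 by apply: ninv_adj.
  have Et : ninv (t * w)%g = (ninv w).+1 by apply: ninv_adj.
  have Ats : ((s * w)%g j < (s * w)%g k)%N by rewrite tperm_mulR tperm_mulD.
  have Ast : ((t * w)%g i < (t * w)%g j)%N by rewrite tperm_mulL tperm_mulD.
  have Ets : ninv (t * (s * w))%g = (ninv w).+2 by rewrite (ninv_adj jk Ats) Es.
  have Est : ninv (s * (t * w))%g = (ninv w).+2 by rewrite (ninv_adj ij Ast) Et.
  have Asts : ((t * (s * w))%g i < (t * (s * w))%g j)%N.
    by rewrite /t tperm_mulL tperm_mulD // /s tperm_mulL tperm_mulD.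
  have Atst : ((s * (t * w))%g j < (s * (t * w))%g k)%N.
    by rewrite /s tperm_mulR tperm_mulD // /t tperm_mulR tperm_mulD.
  have := ninv_le (s * (t * (s * w)))%g; rewrite (ninv_adj ij Asts) Ets => le3.
  have {le3} l1 : (1 < l)%N by lia.
  have [m El] : exists m, l = m.+2 by exists l.-2; lia.
  rewrite {}El in le IH' *.
  have b1 : ('C(N, 2) <= m.+2 + ninv (s * w)%g)%N by rewrite Es; lia.
  have b2 : ('C(N, 2) <= m.+1 + ninv (t * (s * w))%g)%N by rewrite Ets; lia.
  have b3 : ('C(N, 2) <= m.+2 + ninv (t * w)%g)%N by rewrite Et; lia.
  have b4 : ('C(N, 2) <= m.+1 + ninv (s * (t * w))%g)%N by rewrite Est; lia.
  rewrite (IH' _ j k m.+1 (leqnn _) jk Ats b1) (IH' _ i j m (leqnSn _) ij Asts b2).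
  rewrite (IH' _ i j m.+1 (leqnn _) ij Ast b3) (IH' _ j k m (leqnSn _) jk Atst b4).
  have -> : forall f : {mpoly int[N]}, divdiff i j (divdiff j k (divdiff i j f))
      = divdiff j k (divdiff i j (divdiff j k f)) by move=> f; apply: divdiff_braid.
  congr (divdiff _ _ (divdiff _ _ (divdiff _ _ (schubert_rec _ _)))).
  by have := congr1 (fun u => u * w)%g (tperm_braid U); rewrite !mulgA.
move=> w i j ij wij le.
case: (schubert_recS l w) => [[a [b [ab wab ->]]]|[H _]]; last first.
  by have := H _ _ ij; lia.
have nij := adj_neq ij; have nab := adj_neq ab.
have [ai|nai] := eqVneq a i.
  have bj : b = j by apply: val_inj; rewrite /= ab ij ai.
  by rewrite ai bj.
have nbj : b != j.
  apply: contraNneq nai => bj; apply/eqP/val_inj.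
  by move: ij; rewrite -bj ab /= => -[].
have [bi|nbi] := eqVneq b i.
  by subst b; apply: triple.
have [aj|naj] := eqVneq a j.
  by subst a; apply/esym/triple.
have U : uniq [:: i; j; a; b].
  by rewrite /= !inE !negb_or nij nab ![_ == a]eq_sym ![_ == b]eq_sym nai nbi naj nbj.
have U' : uniq [:: a; b; i; j].
  by rewrite /= !inE !negb_or nij nab nai naj nbi nbj.
have A1 : ((tperm a b * w)%g i < (tperm a b * w)%g j)%N by rewrite !tperm_mulD.
have A2 : ((tperm i j * w)%g a < (tperm i j * w)%g b)%N by rewrite !tperm_mulD // eq_sym.
have E1 := ninv_adj ab wab; have E2 := ninv_adj ij wij.
have := ninv_le (tperm i j * (tperm a b * w))%g; rewrite (ninv_adj ij A1) E1 => le2.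
have {le2} l0 : (0 < l)%N by lia.
have [m El] : exists m, l = m.+1 by exists l.-1; lia.
rewrite {}El in le IH' *.
have b1 : ('C(N, 2) <= m.+1 + ninv (tperm a b * w)%g)%N by rewrite E1; lia.
have b2 : ('C(N, 2) <= m.+1 + ninv (tperm i j * w)%g)%N by rewrite E2; lia.
rewrite (IH' _ i j m (leqnn _) ij A1 b1) (IH' _ a b m (leqnn _) ab A2 b2).
rewrite (divdiffC _ U').
congr (divdiff _ _ (divdiff _ _ (schubert_rec _ _))).
by rewrite !mulgA (tperm_comm U).
Qed.

Lemma schubert_rec_fuel (N l : nat) (w : 'S_N) : ('C(N, 2) <= l + ninv w)%N ->
  schubert_rec l.+1 w = schubert_rec l w.
Proof.
elim: l w => [|l IH] w le.
  case: (schubert_recS 0 w) => [[i [j [ij wij _]]]|[_ H]]; last by rewrite !H.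
  by have := ninv_le (tperm i j * w)%g; rewrite (ninv_adj ij wij); lia.
case: (schubert_recS l.+1 w) => [[i [j [ij wij ->]]]|[_ H]]; last by rewrite !H.
rewrite (schubert_rec_ascent ij wij le); congr (divdiff i j _).
by apply: IH; rewrite (ninv_adj ij wij); lia.
Qed.

Lemma schubert_ascent (N : nat) (w : 'S_N) (i j : 'I_N) :
  j = i.+1 :> nat -> (w i < w j)%N ->
  schubert w = divdiff i j (schubert (tperm i j * w)%g).
Proof.
move=> ij wij; rewrite /schubert -schubert_rec_fuel ?leq_addr //.
by apply: schubert_rec_ascent => //; lia.
Qed.

Lemma schubert_no_ascent (N : nat) (w : 'S_N) :
  (forall i j : 'I_N, j = i.+1 :> nat -> (w j < w i)%N) ->
  schubert w = \prod_(i < N) 'X_i ^+ (N - i.+1).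
Proof.
move=> H; rewrite /schubert; case: (schubert_recS 0 w) => [[i [j [ij wij _]]]|[_ ->]] //.
by have := H _ _ ij; lia.
Qed.

Lemma divdiff_schubert_ascent (N : nat) (w : 'S_N) (i j : 'I_N) :
  j = i.+1 :> nat -> (w i < w j)%N -> divdiff i j (schubert w) = 0.
Proof.
move=> ij wij; apply: divdiff_sym0; first exact: adj_neq.
by rewrite (schubert_ascent ij wij) msym_divdiff // adj_neq.
Qed.

Lemma divdiff_schubert_descent (N : nat) (w : 'S_N) (i j : 'I_N) :
  j = i.+1 :> nat -> (w j < w i)%N ->
  divdiff i j (schubert w) = schubert (tperm i j * w)%g.
Proof.
move=> ij wij; have := schubert_ascent (w := (tperm i j * w)%g) ij.
by rewrite tperm_mulL tperm_mulR mulgA tperm2 mul1g => /(_ wij) ->.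
Qed.

(** Downward induction on the length: P passes to w from the permutations with
    one more inversion. *)
Lemma perm_ascent_ind (N : nat) (P : 'S_N -> Prop) :
  (forall w : 'S_N, (forall v, ninv v = (ninv w).+1 -> P v) -> P w) ->
  forall w, P w.
Proof.
move=> Ps w; have [n] := ubnP ('C(N, 2) - ninv w); elim: n w => // n IH w le.
by apply: Ps => v Ev; apply: IH; have := ninv_le v; lia.
Qed.

Lemma divdiffXn (N : nat) (i j : 'I_N) (e : nat) : i != j ->
  divdiff i j ('X_i ^+ e) = \sum_(t < e) 'X_i ^+ (e.-1 - t) * 'X_j ^+ t.
Proof.
move=> ij; apply: divdiff_unique => //.
by rewrite rmorphXn /= msymXi tpermL subrXX; congr (_ * _).
Qed.

Lemma msym_tpermX (N : nat) (i j : 'I_N) (m : 'X_{1..N}) : m i = m j ->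
  msym (tperm i j) 'X_[m] = 'X_[m] :> {mpoly int[N]}.
Proof.
move=> mij; rewrite msymX; congr 'X_[_]; apply/mnmP=> k; rewrite mnmE tpermV.
by case: tpermP => [->|->|].
Qed.

(** The divided difference of a monomial, written as a monomial symmetric in the
    two variables times a power of the first one. *)
Lemma divdiffX (N : nat) (i j : 'I_N) (m : 'X_{1..N}) (e : nat) : i != j ->
  m i = m j ->
  divdiff i j 'X_[m + U_(i) *+ e]
  = \sum_(t < e) 'X_[m + U_(i) *+ (e.-1 - t) + U_(j) *+ t].
Proof.
move=> ij mij; rewrite mpolyXD -mpolyXn divdiffM_sym // ?msym_tpermX // divdiffXn //.
by rewrite big_distrr /=; apply: eq_bigr => t _; rewrite !mpolyXD -!mpolyXn mulrA.
Qed.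

(** Homogeneous of degree d, with every exponent vector under the staircase
    (N-1, N-2, ..., 0). *)
Definition staircase_homog (N d : nat) (f : {mpoly int[N]}) : Prop :=
  forall m : 'X_{1..N}, m \in msupp f ->
    (forall i, m i <= N - i.+1)%N /\ mdeg m = d.

Lemma staircase_homogX (N d : nat) (m : 'X_{1..N}) :
  (forall i, m i <= N - i.+1)%N -> mdeg m = d -> staircase_homog d 'X_[m].
Proof. by move=> mle md m'; rewrite msuppX inE => /eqP->. Qed.

Lemma staircase_homog_sum (N d : nat) (I : Type) (r : seq I) (P : pred I)
    (F : I -> {mpoly int[N]}) :
  (forall i, P i -> staircase_homog d (F i)) ->
  staircase_homog d (\sum_(i <- r | P i) F i).
Proof.
move=> HF; apply: big_ind => // [m|f g Hf Hg m]; first by rewrite msupp0.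
by move/msuppD_le; rewrite mem_cat => /orP[/Hf|/Hg].
Qed.

Lemma staircase_homogZ (N d : nat) (c : int) (f : {mpoly int[N]}) :
  staircase_homog d f -> staircase_homog d (c *: f).
Proof. by move=> Hf m /msuppZ_le/Hf. Qed.

Lemma divdiffZ (N : nat) (i j : 'I_N) (c : int) (f : {mpoly int[N]}) : i != j ->
  divdiff i j (c *: f) = c *: divdiff i j f.
Proof.
move=> ij; rewrite -!mul_mpolyC divdiffM_sym //.
by rewrite -[c%:MP]mulr1 mul_mpolyC msymZ msym1.
Qed.

Lemma mnm_shift (N : nat) (i j : 'I_N) (m : 'X_{1..N}) : (m j <= m i)%N ->
  exists2 r : 'X_{1..N}, r i = r j & m = (r + U_(i) *+ (m i - m j))%MM.
Proof.
move=> le; exists (m - U_(i) *+ (m i - m j))%MM.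
  rewrite !mnmBE !mulmnE !mnm1E eqxx; have [->//|ij] := eqVneq i j.
  by rewrite mul1n mul0n subn0 subKn.
apply/mnmP=> k; rewrite mnmDE !mnmBE !mulmnE !mnm1E; case: eqP => [<-|_]; lia.
Qed.

Lemma staircase_homog_divdiffX (N d : nat) (i j : 'I_N) (m : 'X_{1..N}) :
  j = i.+1 :> nat -> (forall k, m k <= N - k.+1)%N -> mdeg m = d.+1 ->
  (m j <= m i)%N -> staircase_homog d (divdiff i j 'X_[m]).
Proof.
move=> ij mle md le; have nij := adj_neq ij; have [r rij Em] := mnm_shift le.
move: (m i - m j)%N Em => e Em {le}.
have Ek k : m k = (r k + (i == k) * e)%N by rewrite Em mnmDE mulmnE mnm1E.
rewrite Em divdiffX //; apply: staircase_homog_sum => t _; have te := ltn_ord t.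
apply: staircase_homogX => [k|].
  rewrite !mnmDE !mulmnE !mnm1E; have := mle k; have := mle i; rewrite !Ek eqxx mul1n.
  have [<-|ik] := eqVneq i k; first by rewrite eq_sym (negbTE nij) mul1n mul0n; lia.
  have [<-|jk] := eqVneq j k; last by lia.
  by rewrite -rij mul1n mul0n ij; lia.
move: md; rewrite Em !mdegD !mdegMn !mdeg1 !mul1n; lia.
Qed.

Lemma staircase_homog_divdiff (N d : nat) (i j : 'I_N) (f : {mpoly int[N]}) :
  j = i.+1 :> nat -> staircase_homog d.+1 f -> staircase_homog d (divdiff i j f).
Proof.
move=> ij Hf; have nij := adj_neq ij.
rewrite [f]mpolyE divdiff_sum // big_seq; apply: staircase_homog_sum => m /Hf[mle md].
rewrite divdiffZ //; apply: staircase_homogZ.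
have [le|lt] := leqP (m j) (m i); first exact: staircase_homog_divdiffX.
(* otherwise exchange the two exponents, which only changes the sign *)
pose m' := [multinom m (tperm i j k) | k < N].
have Em : 'X_[m] = msym (tperm i j) 'X_[m'] :> {mpoly int[N]}.
  by rewrite msymX; congr 'X_[_]; apply/mnmP=> k; rewrite !mnmE tpermV tpermK.
rewrite Em divdiff_msym // -scaleN1r; apply: staircase_homogZ.
apply: staircase_homog_divdiffX => // [k||]; rewrite ?mnmE ?tpermL ?tpermR ?(ltnW lt) //.
  by case: tpermP => [->|->|] //; have := mle j; have := mle i; rewrite ij; lia.
rewrite -md !mdegE (reindex_inj (@perm_inj _ (tperm i j))) /=.
by apply: eq_bigr => k _; rewrite mnmE tpermK.
Qed.

(** The code of w as an exponent vector. *)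
Definition code_mnm (N : nat) (w : 'S_N) : 'X_{1..N} := [multinom code w i | i < N].

Lemma schubert_decreasing (N : nat) (w : 'S_N) :
  (forall i j : 'I_N, j = i.+1 :> nat -> (w j < w i)%N) ->
  schubert w = 'X_[code_mnm w].
Proof.
move=> dec; rewrite schubert_no_ascent // [RHS]mpolyXE_id.
by apply: eq_bigr => i _; rewrite mnmE code_no_ascent.
Qed.

Lemma schubert_staircase (N : nat) (w : 'S_N) : staircase_homog (ninv w) (schubert w).
Proof.
elim/perm_ascent_ind: w => w IH.
have [[i [j [ij wij]]]|dec] := ascent_or_decreasing w.
  rewrite (schubert_ascent ij wij); apply: staircase_homog_divdiff => //.
  by have E := ninv_adj ij wij; rewrite -E; apply: IH.
rewrite schubert_decreasing //; apply: staircase_homogX => [i|].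
  by rewrite mnmE code_le.
by rewrite mdegE; apply: eq_bigr => i _; rewrite mnmE.
Qed.

(** The Schubert polynomial of a dominant permutation, whose code is a partition,
    is a monomial: going up through the first ascent i adds 1 to the code at i
    and keeps it a partition. *)
Lemma schubert_dominant (N : nat) (w : 'S_N) :
  (forall i j : 'I_N, j = i.+1 :> nat -> code w j <= code w i)%N ->
  schubert w = 'X_[code_mnm w].
Proof.
elim/perm_ascent_ind: w => w IH dom.
have [[i0 [j0 [ij0 wij0]]]|dec] := ascent_or_decreasing w; last first.
  exact: schubert_decreasing.
pose asc (n : nat) := [exists i : 'I_N, exists j : 'I_N,
  [&& i == n :> nat, j == i.+1 :> nat & (w i < w j)%N]].
have asc_i (i j : 'I_N) : j = i.+1 :> nat -> (w i < w j)%N -> asc i.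
  move=> ij wij; apply/existsP; exists i; apply/existsP; exists j.
  by rewrite eqxx ij eqxx.
have : exists n, asc n by exists i0; apply: asc_i wij0.
case/ex_minnP=> n /existsP[i /existsP[j /and3P[/eqP En /eqP ij wij]]] min.
have nij := adj_neq ij; have nji : j != i by rewrite eq_sym.
have cij : code w i = code w j.
  apply/eqP; rewrite eqn_leq (dom _ _ ij) andbT; apply/subset_leq_card/subsetP=> k.
  rewrite !inE ij => /andP[ik wki]; rewrite (ltn_trans wki wij) andbT ltn_neqAle ik andbT.
  apply: contraTneq wki => ek; rewrite -leqNgt ltnW //.
  by have <- : j = k by apply: val_inj; rewrite /= ij.
have Ec : code_mnm (tperm i j * w)%g = (code_mnm w + U_(i) *+ 1)%MM.
  apply/mnmP=> k; rewrite mnmDE mulmnE mnm1E !mnmE; have [<-|ik] := eqVneq i k.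
    by rewrite code_adj_left // cij mul1n addn1.
  have [<-|jk] := eqVneq j k; first by rewrite code_adj_right // cij mul0n addn0.
  by rewrite code_adj_other ?addn0 // eq_sym.
rewrite (schubert_ascent ij wij) IH ?Ec; last 2 first.
- exact: ninv_adj.
- move=> k l kl.
  have E (x : 'I_N) : code (tperm i j * w)%g x = (code w x + (x == i))%N.
    have := congr1 (fun m : 'X_{1..N} => m x) Ec.
    by rewrite mnmDE mulmnE mnm1E !mnmE muln1 eq_sym.
  rewrite !E; have [lei|li] := eqVneq l i; last by have := dom k l kl; lia.
  have ki : k != i by rewrite -lei; apply: adj_neq.
  rewrite (negbTE ki) addn0 addn1 lei [X in (_ <= X)%N]/code.
  rewrite (cardD1 i [set x : 'I_N | (k < x)%N && (w x < w k)%N]) inE.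
  have /orP[wkl|wlk] := adj_cases w kl.
    have : (n <= k)%N by apply: min; apply: asc_i wkl.
    by rewrite -En -lei kl ltnn.
  rewrite -lei kl leqnn wlk ltnS; apply/subset_leq_card/subsetP=> x.
  rewrite !inE kl => /andP[lx wx]; rewrite (ltn_trans wx wlk) andbT.
  by rewrite -val_eqE /= kl; lia.
rewrite divdiffX ?mnmE // big_ord1 /= subnn.
by congr 'X_[_]; apply/mnmP=> k; rewrite !mnmDE !mulmnE !muln0 !addn0.
Qed.

Lemma schubert1 (N : nat) : schubert (1%g : 'S_N) = 1.
Proof.
have c0 (i : 'I_N) : code (1%g : 'S_N) i = 0%N.
  by apply: eq_card0 => j; rewrite !inE !perm1; lia.
rewrite schubert_dominant => [|i j _]; last by rewrite !c0.
by rewrite -mpolyX0; congr 'X_[_]; apply/mnmP=> i; rewrite !mnmE c0.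
Qed.

(** * Elementary and complete symmetric polynomials *)

(** The elementary symmetric polynomial e_r(x_0, ..., x_{k-1}). *)
Fixpoint esum (R : comNzRingType) (x : nat -> R) (k r : nat) : R :=
  if k is k'.+1 then
    esum x k' r + x k' * (if r is r'.+1 then esum x k' r' else 0)
  else (r == 0%N)%:R.

(** The complete homogeneous symmetric polynomial h_r(x_0, ..., x_{k-1}). *)
Fixpoint hsum (R : comNzRingType) (x : nat -> R) (k : nat) : nat -> R :=
  if k is k'.+1 then
    fix hk r := if r is r'.+1 then hsum x k' r + x k' * hk r' else hsum x k' 0%N
  else fun r => (r == 0%N)%:R.

Lemma hsumSS (R : comNzRingType) (x : nat -> R) (k r : nat) :
  hsum x k.+1 r.+1 = hsum x k r.+1 + x k * hsum x k.+1 r.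
Proof. by []. Qed.

Lemma esumSS (R : comNzRingType) (x : nat -> R) (k r : nat) :
  esum x k.+1 r.+1 = esum x k r.+1 + x k * esum x k r.
Proof. by []. Qed.

Lemma hsum0 (R : comNzRingType) (x : nat -> R) (k : nat) : hsum x k 0 = 1.
Proof. by elim: k => //= k ->. Qed.

Lemma esum0 (R : comNzRingType) (x : nat -> R) (k : nat) : esum x k 0 = 1.
Proof. by elim: k => //= k ->; rewrite mulr0 addr0. Qed.

Lemma hsum0n (R : comNzRingType) (x : nat -> R) (r : nat) :
  hsum x 0 r = (r == 0%N)%:R.
Proof. by []. Qed.



#[local] Arguments esum : simpl never.
#[local] Arguments hsum : simpl never.

(** The coefficient of degree r in the quotient of prod_{i < l} (1 + x_i t) by
    prod_{i < k} (1 + x_i t). *)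
Definition hesum (R : comNzRingType) (x : nat -> R) (k l r : nat) : R :=
  \sum_(a < r.+1) (-1) ^+ a * hsum x k a * esum x l (r - a).

Lemma hesum_er (R : comNzRingType) (x : nat -> R) (k l r : nat) :
  hesum x k l.+1 r.+1 = hesum x k l r.+1 + x l * hesum x k l r.
Proof.
rewrite /hesum big_ord_recr [in RHS]big_ord_recr /= subnn !esum0.
rewrite addrAC mulr_sumr -big_split /=; congr (_ + _).
apply: eq_bigr => a _; have la : (a <= r)%N by rewrite -ltnS.
by rewrite subSn // esumSS; ring.
Qed.

Lemma hesum_hr (R : comNzRingType) (x : nat -> R) (k l r : nat) :
  hesum x k.+1 l r.+1 + x k * hesum x k.+1 l r = hesum x k l r.+1.
Proof.
rewrite /hesum big_ord_recl [in RHS]big_ord_recl /= !hsum0 -addrA; congr (_ + _).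
rewrite mulr_sumr -big_split /=; apply: eq_bigr => a _.
by rewrite /bump leq0n add1n !subSS !exprS hsumSS; ring.
Qed.

Lemma hesum_diag (R : comNzRingType) (x : nat -> R) (k r : nat) :
  hesum x k k r = (r == 0%N)%:R.
Proof.
elim: k r => [|k IH] [|r]; rewrite ?eqxx.
- by rewrite /hesum big_ord1 hsum0 esum0 !mul1r.
- rewrite /hesum big1 // => -[[|a] la] _ /=; rewrite hsum0n ?mulr0 ?mul0r //.
- by rewrite /hesum big_ord1 hsum0 esum0 !mul1r.
by rewrite hesum_er hesum_hr IH.
Qed.

Lemma hesum_vanish (R : comNzRingType) (x : nat -> R) (k l r : nat) :
  (k <= l)%N -> (l - k < r)%N -> hesum x k l r = 0.
Proof.
elim: l r => [|l IH] r kl lr.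
  by case: k kl lr => // _; rewrite hesum_diag; case: r.
move: kl lr; rewrite leq_eqVlt => /orP[/eqP->|kl].
  by rewrite subnn hesum_diag; case: r.
case: r => // r; rewrite subSn // ltnS => lr.
by rewrite hesum_er !IH ?mulr0 ?addr0 // ltnW.
Qed.

(** The unitriangular matrix with entry e_{q-p}(x_0, ..., x_{q-1}) at (p, q). *)
Definition emx (R : comNzRingType) (N : nat) (x : nat -> R) : 'M[R]_N :=
  \matrix_(p, q) if (p <= q)%N then esum x q (q - p) else 0.

(** h_{q-p}(x_0, ..., x_p), which is zero for q < p. Up to sign these are the
    entries of the inverse of [emx]. *)
Definition hval (R : comNzRingType) (x : nat -> R) (p q : nat) : R :=
  if (p <= q)%N then hsum x p.+1 (q - p) else 0.

Lemma hval_emx (R : comNzRingType) (N : nat) (x : nat -> R) :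
  (\matrix_(p, q) ((-1) ^+ (q - p) * hval x p q)) *m emx N x = 1%:M.
Proof.
apply/matrixP=> p s; rewrite !mxE.
have [ps|sp] := leqP p s; last first.
  rewrite big1 => [|q _]; first by rewrite -val_eqE /=; case: eqP => // E; lia.
  rewrite !mxE /hval; case: leqP => pq; last by rewrite mulr0 mul0r.
  by rewrite leqNgt (leq_trans sp pq) mulr0.
transitivity (hesum x p.+1 s (s - p)).
  pose G n := (-1) ^+ (n - p) * hval x p n * (if (n <= s)%N then esum x s (s - n) else 0).
  rewrite (eq_bigr (fun q : 'I_N => G q)) => [|q _]; last by rewrite !mxE.
  rewrite -(big_mkord xpredT G) (big_cat_nat (n := p)) //=; last exact: ltnW.
  rewrite big_nat big1 ?add0r => [|n /andP[_ np]]; last first.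
    by rewrite /G /hval leqNgt np mulr0 mul0r.
  rewrite (big_cat_nat (n := s.+1)) //=; last by rewrite ltnW.
  rewrite [X in _ + X]big_nat [X in _ + X]big1 ?addr0 => [|n /andP[sn _]]; last first.
    by rewrite /G leqNgt sn mulr0.
  rewrite -{1}[p : nat]add0n big_addn big_mkord subSn // /hesum.
  apply: eq_bigr => a _; rewrite /G /hval leq_addl addnK.
  have -> : (a + p <= s)%N by have := ltn_ord a; lia.
  by congr (_ * esum _ _ _); lia.
have [->|nps] := eqVneq p s; first by rewrite subnn /hesum big_ord1 hsum0 esum0 !mul1r.
have lps : (p < s)%N by move: nps; rewrite -val_eqE /=; lia.
by rewrite hesum_vanish //; lia.
Qed.

Lemma hsum_fix (R : comNzRingType) (s : {rmorphism R -> R}) (x : nat -> R)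
    (k r : nat) :
  (forall l, (l < k)%N -> s (x l) = x l) -> s (hsum x k r) = hsum x k r.
Proof.
elim: k r => [|k IH] r Hx; first by rewrite hsum0n rmorph_nat.
have {}IH r' := IH r' (fun l lk => Hx l (ltnW lk)).
elim: r => [|r IHr]; first by rewrite hsum0 rmorph1.
by rewrite hsumSS rmorphD rmorphM IH Hx // IHr.
Qed.

(** The divided difference at i of h_{r+1}(x_0, ..., x_i) is
    h_r(x_0, ..., x_{i+1}). *)
Lemma hsum_divdiff (R : comNzRingType) (s : {rmorphism R -> R}) (x : nat -> R)
    (i r : nat) :
  (forall l, (l < i)%N -> s (x l) = x l) -> s (x i) = x i.+1 ->
  (x i - x i.+1) * hsum x i.+2 r = hsum x i.+1 r.+1 - s (hsum x i.+1 r.+1).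
Proof.
move=> Hx si; have Ai r' := hsum_fix r' Hx.
elim: r => [|r IH].
  by rewrite !hsumSS rmorphD rmorphM Ai !hsum0 rmorph1 si; ring.
have EC := hsumSS x i.+1 r; have EB := hsumSS x i r.+1.
have EsB : s (hsum x i.+1 r.+2) = hsum x i r.+2 + x i.+1 * s (hsum x i.+1 r.+1).
  by rewrite EB rmorphD rmorphM Ai si.
rewrite EC EsB EB mulrDr [X in _ + X]mulrCA IH.
by ring.
Qed.

(** The variables as a sequence indexed by nat, zero past the last one. *)
Definition xvar (N : nat) (k : nat) : {mpoly int[N]} :=
  if insub k is Some i then 'X_i else 0.

Lemma xvarE (N : nat) (i : 'I_N) : xvar N i = 'X_i.
Proof. by rewrite /xvar; case: insubP => [j _ /val_inj->|]; rewrite ?ltn_ord. Qed.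

Lemma msym_xvar (N : nat) (i j : 'I_N) (l : nat) : l != i -> l != j ->
  msym (tperm i j) (xvar N l) = xvar N l.
Proof.
rewrite /xvar; case: insubP => [k _ <-|_] li lj; last by rewrite msym0.
by rewrite msymXi tpermD // -val_eqE /= eq_sym.
Qed.

Lemma divdiff_hval (N : nat) (i j : 'I_N) (q : nat) : j = i.+1 :> nat ->
  divdiff i j (hval (xvar N) i q) = hval (xvar N) j q.
Proof.
move=> ij; have nij := adj_neq ij.
rewrite /hval; have [iq|iq] := leqP i q; last first.
  by rewrite ij ltnNge (ltnW iq) /= divdiff_sym0 // msym0.
rewrite ij; have [lt|le] := ltnP i q; last first.
  have -> : (q - i = 0)%N by lia.
  by rewrite hsum0 divdiff_sym0 // msym1.
have -> : (q - i = (q - i.+1).+1)%N by lia.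
apply: divdiff_unique => //.
have := hsum_divdiff (s := msym (tperm i j)) (x := xvar N) (i := i) (q - i.+1).
rewrite -ij !xvarE /= => -> //; last by rewrite msymXi tpermL.
by move=> l li; apply: msym_xvar; lia.
Qed.

Lemma msym_hval (N : nat) (i j : 'I_N) (p q : nat) : j = i.+1 :> nat -> p != i ->
  msym (tperm i j) (hval (xvar N) p q) = hval (xvar N) p q.
Proof.
move=> ij pi; rewrite /hval; case: leqP => _; last by rewrite msym0.
move: (q - p)%N => r; have [lt|le] := ltnP p i.
  by apply: hsum_fix => l lp; apply: msym_xvar; lia.
have {le pi} : (j <= p)%N by lia.
elim: p r => [|p IH] r; first by lia.
rewrite leq_eqVlt => /orP[/eqP E|jp].
  have := divdiff_hval (p.+1 + r) ij; rewrite /hval E.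
  have -> : (p < p.+1 + r)%N by lia.
  rewrite addKn => <-.
  exact/msym_divdiff/adj_neq.
elim: r => [|r IHr]; first by rewrite hsum0 msym1.
by rewrite hsumSS msymD msymM IH // IHr msym_xvar //; lia.
Qed.

(** * The flagged determinant of a 321-avoiding permutation *)

Lemma msym_det (N m : nat) (s : 'S_N) (M : 'M[{mpoly int[N]}]_m) :
  msym s (\det M) = \det (map_mx (msym s) M).
Proof. by symmetry; apply: (det_map_mx (msym s)). Qed.

Lemma divdiff_det (N : nat) (i j c : 'I_N) (M M' : 'M[{mpoly int[N]}]_N) : i != j ->
  (forall a b, b != c -> msym (tperm i j) (M a b) = M a b) ->
  (forall a b, b != c -> M' a b = M a b) ->
  (forall a, M' a c = divdiff i j (M a c)) ->
  divdiff i j (\det M) = \det M'.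
Proof.
move=> ij HM HM' Hc; rewrite (expand_det_col M c) (expand_det_col M' c).
rewrite divdiff_sum //; apply: eq_bigr => a _.
have -> : cofactor M' a c = cofactor M a c.
  rewrite /cofactor; congr (_ * \det _); apply/matrixP=> k l; rewrite !mxE.
  by apply: HM'; rewrite eq_sym neq_lift.
rewrite Hc mulrC divdiffM_sym //; first exact: mulrC.
rewrite /cofactor msymM msym_det rmorphXn rmorphN rmorph1; congr (_ * \det _).
apply/matrixP=> k l; rewrite !mxE; apply: HM; by rewrite eq_sym neq_lift.
Qed.

Lemma divdiff_det0 (N : nat) (i j : 'I_N) (M : 'M[{mpoly int[N]}]_N) : i != j ->
  (forall a b, msym (tperm i j) (M a b) = M a b) -> divdiff i j (\det M) = 0.
Proof.
move=> ij HM; apply: divdiff_sym0 => //; rewrite msym_det; congr (\det _).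
by apply/matrixP=> a b; rewrite mxE HM.
Qed.

Lemma det_eq_cols (R : comNzRingType) (N : nat) (M : 'M[R]_N) (i j : 'I_N) :
  i != j -> (forall a, M a i = M a j) -> \det M = 0.
Proof.
move=> ij E; rewrite -det_tr; apply: (determinant_alternate ij) => a.
by rewrite !mxE E.
Qed.

Lemma det_perm_conj (R : comNzRingType) (N : nat) (M : 'M[R]_N) (s : 'S_N) :
  \det (\matrix_(i, j) M (s i) (s j)) = \det M.
Proof.
have -> : \matrix_(i, j) M (s i) (s j) = col_perm s (row_perm s M).
  by apply/matrixP=> i j; rewrite !mxE.
rewrite col_permE row_permE !det_mulmx !det_perm odd_permV mulrAC -signr_addb.
by rewrite addbb mul1r.
Qed.

(** A column with unit pivot may be replaced by a unit vector, provided that the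
    determinant vanishes once the pivot is replaced by zero. *)
Lemma det_col_unit (R : comNzRingType) (N : nat) (M : 'M[R]_N) (i : 'I_N) :
  M i i = 1 ->
  \det (\matrix_(a, b) if b == i then (if a == i then 0 else M a b) else M a b) = 0 ->
  \det M = \det (\matrix_(a, b) if b == i then (a == i)%:R else M a b).
Proof.
set B := \matrix_(a, b) _; set A := \matrix_(a, b) _ => Mii B0.
rewrite -[LHS]det_tr -[RHS]det_tr -[RHS]addr0 -[in RHS]B0 -[\det B]det_tr.
rewrite -[\det A^T]mul1r -[\det B^T]mul1r.
apply: (determinant_multilinear (i0 := i)).
- apply/rowP=> a; rewrite !mxE eqxx !mul1r; case: (eqVneq a i) => [->|_].
    by rewrite Mii addr0.
  by rewrite add0r.
- by apply/matrixP=> a b; rewrite !mxE eq_sym (negbTE (neq_lift _ _)).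
- by apply/matrixP=> a b; rewrite !mxE eq_sym (negbTE (neq_lift _ _)).
Qed.

(** The matrix with entry h_{w(i)-j}(x_0, ..., x_j) at (i, j) for an excedance j,
    and with unit columns elsewhere. Its determinant is the principal minor on
    the excedances; the rows outside them are irrelevant. *)
Definition excmx (N : nat) (w : 'S_N) : 'M[{mpoly int[N]}]_N :=
  \matrix_(i, j) if j \in exc w then hval (xvar N) j (w i) else (i == j)%:R.

(** [excmx w] after a divided difference at an excedance k, with l = k + 1: column
    k then involves one more variable, and the other columns are unchanged. *)
Definition excmx_step (N : nat) (w : 'S_N) (k l : 'I_N) : 'M[{mpoly int[N]}]_N :=
  \matrix_(i, j) if j == k then hval (xvar N) l (w i) else excmx w i j.

Lemma msym_excmx (N : nat) (w : 'S_N) (i j a b : 'I_N) : j = i.+1 :> nat ->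
  (b != i) || (i \notin exc w) -> msym (tperm i j) (excmx w a b) = excmx w a b.
Proof.
move=> ij; rewrite mxE; case: ifP => [bw|_ _]; last by rewrite rmorph_nat.
have [E|bi _] := eqVneq b i; last by apply: msym_hval.
by move=> /= iw; rewrite -E bw in iw.
Qed.

Lemma divdiff_excmx_nonexc (N : nat) (w : 'S_N) (i j : 'I_N) : j = i.+1 :> nat ->
  i \notin exc w -> divdiff i j (\det (excmx w)) = 0.
Proof.
move=> ij iw; apply: divdiff_det0; first exact: adj_neq.
by move=> a b; apply: msym_excmx => //; rewrite iw orbT.
Qed.

Lemma divdiff_excmx_exc (N : nat) (w : 'S_N) (i j : 'I_N) : j = i.+1 :> nat ->
  i \in exc w -> divdiff i j (\det (excmx w)) = \det (excmx_step w i j).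
Proof.
move=> ij iw; apply: (divdiff_det (c := i)) => [|a b bi|a b bi|a].
- exact: adj_neq.
- by apply: msym_excmx; rewrite ?bi.
- by rewrite mxE (negbTE bi).
by rewrite !mxE eqxx iw divdiff_hval.
Qed.

Lemma divdiff_excmx_exc2 (N : nat) (w : 'S_N) (i j : 'I_N) : j = i.+1 :> nat ->
  i \in exc w -> j \in exc w -> divdiff i j (\det (excmx w)) = 0.
Proof.
move=> ij iw jw; have nij := adj_neq ij; rewrite divdiff_excmx_exc //.
apply: (det_eq_cols nij) => a; rewrite !mxE eqxx eq_sym (negbTE nij).
by rewrite jw.
Qed.

(** If w(i) > i + 1, the two matrices are conjugate by the transposition. *)
Lemma det_excmx_step_ne (N : nat) (w : 'S_N) (i j : 'I_N) : avoids_321 w ->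
  j = i.+1 :> nat -> (w j < w i)%N -> w i != j ->
  \det (excmx_step w i j) = \det (excmx (tperm i j * w)%g).
Proof.
move=> hw ij wij wi; have [iw jw _] := descent_exc hw ij wij.
rewrite -[RHS](det_perm_conj _ (tperm i j)); congr (\det _); apply/matrixP=> a b.
rewrite !mxE exc_descent // (negbTE wi) permM tpermK (inj_eq perm_inj) !in_setU1 ?in_setD1.
have nij := adj_neq ij; have nji : (j == i) = false by rewrite eq_sym (negbTE nij).
case: (tpermP i j b) => [->|->|/eqP bi /eqP bj].
- by rewrite !eqxx.
- by rewrite nji (negbTE jw) (negbTE nij) eqxx.
by rewrite (negbTE bi) (negbTE bj).
Qed.

(** If w(i) = i + 1, column i has 1 on the diagonal and, apart from this entry,
    meets the excedance rows up to i only in zeros, as do the columns of the later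
    excedances. So it may be replaced by the unit column that [excmx] has after i
    is no longer an excedance. *)
Lemma det_excmx_step_eq (N : nat) (w : 'S_N) (i j : 'I_N) : avoids_321 w ->
  j = i.+1 :> nat -> (w j < w i)%N -> w i = j ->
  \det (excmx_step w i j) = \det (excmx (tperm i j * w)%g).
Proof.
move=> hw ij wij wi; have [iw jw _] := descent_exc hw ij wij.
have nij := adj_neq ij; have nji : (j == i) = false by rewrite eq_sym (negbTE nij).
pose A : 'M[{mpoly int[N]}]_N :=
  \matrix_(a, b) if b == i then (a == i)%:R else excmx_step w i j a b.
pose B : 'M[{mpoly int[N]}]_N :=
  \matrix_(a, b) if b == i then (if a == i then 0 else excmx_step w i j a b)
                 else excmx_step w i j a b.
have B0 : \det B = 0.
  pose I := [set a : 'I_N | (a \in exc w) && (a <= i)%N].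
  pose J := [set b : 'I_N | (b \notin exc w) || (i <= b)%N].
  apply: (det_zero_block (I := I) (J := J)) => [a b|].
    rewrite !inE => /andP[aw ai] bJ; rewrite !mxE inE.
    have wa : (w a <= w i)%N.
      move: ai; rewrite leq_eqVlt => /orP[/eqP/val_inj->//|ai].
      by apply/ltnW/exc_gt.
    have [bi|bi] := eqVneq b i.
      have [//|ai'] := eqVneq a i.
      have {}ai : (a < i)%N by rewrite ltn_neqAle ai' ai.
      by rewrite /hval leqNgt -wi (exc_gt hw iw ai).
    case: ifP => [bw|/negbT bw]; last first.
      by case: eqP => // ab; rewrite -ab aw in bw.
    rewrite bw /= in bJ; rewrite /hval leqNgt.
    have ib : (i < b)%N by rewrite ltn_neqAle eq_sym bi.
    have jb : (j <= b)%N by rewrite ij.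
    have {}jb : (j < b)%N.
      rewrite ltn_neqAle jb andbT; apply: contraNneq jw => /val_inj->.
      by rewrite inE.
    by rewrite (leq_ltn_trans wa) // wi.
  have -> : J = ~: (I :\ i).
    by apply/setP=> b; rewrite !inE -[b == i]val_eqE /=; lia.
  have iI : i \in I by rewrite inE iw leqnn.
  have := cardsC (I :\ i); rewrite card_ord => {1}<-.
  by rewrite ltn_add2r [in X in (_ < X)%N](cardsD1 i) iI.
have hii : excmx_step w i j i i = 1.
  by rewrite mxE eqxx /hval wi leqnn subnn hsum0.
rewrite (det_col_unit hii B0).
rewrite -[RHS](det_perm_conj _ (tperm i j)); congr (\det _); apply/matrixP=> a b.
rewrite !mxE exc_descent // wi eqxx permM tpermK (inj_eq perm_inj) in_setD1.
case: (tpermP i j b) => [->|->|/eqP bi /eqP bj].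
- by rewrite eqxx nji (negbTE jw).
- by rewrite nji (negbTE jw) eqxx.
by rewrite (negbTE bi).
Qed.

Lemma divdiff_excmx_descent (N : nat) (w : 'S_N) (i j : 'I_N) : avoids_321 w ->
  j = i.+1 :> nat -> (w j < w i)%N ->
  divdiff i j (\det (excmx w)) = \det (excmx (tperm i j * w)%g).
Proof.
move=> hw ij wij; have [iw _ _] := descent_exc hw ij wij.
rewrite divdiff_excmx_exc //; have [wi|wi] := eqVneq (w i) j.
  exact: det_excmx_step_eq.
exact: det_excmx_step_ne.
Qed.

Lemma divdiff_excmx_ascent (N : nat) (w : 'S_N) (i j : 'I_N) : avoids_321 w ->
  j = i.+1 :> nat -> (w i < w j)%N -> divdiff i j (\det (excmx w)) = 0.
Proof.
move=> hw ij wij; have [iw|iw] := boolP (i \in exc w); last exact: divdiff_excmx_nonexc.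
apply: divdiff_excmx_exc2 => //; rewrite !inE in iw *.
by rewrite ij (leq_ltn_trans iw wij).
Qed.

Lemma excmx1 (N : nat) : \det (excmx (1%g : 'S_N)) = 1.
Proof.
have -> : excmx (1%g : 'S_N) = 1%:M; last exact: det1.
by apply/matrixP=> i j; rewrite !mxE inE perm1 ltnn.
Qed.

(** f does not involve the last variable. *)
Definition last_free (n : nat) (f : {mpoly int[n.+1]}) : Prop :=
  forall m : 'X_{1..n.+1}, m \in msupp f -> m ord_max = 0%N.

Lemma last_free0 (n : nat) : last_free (0 : {mpoly int[n.+1]}).
Proof. by move=> m; rewrite msupp0. Qed.

Lemma last_free1 (n : nat) : last_free (1 : {mpoly int[n.+1]}).
Proof. by move=> m; rewrite msupp1 inE => /eqP->; rewrite mnm0E. Qed.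

Lemma last_freeD (n : nat) (f g : {mpoly int[n.+1]}) :
  last_free f -> last_free g -> last_free (f + g).
Proof. by move=> Hf Hg m /msuppD_le; rewrite mem_cat => /orP[/Hf|/Hg]. Qed.

Lemma last_freeN (n : nat) (f : {mpoly int[n.+1]}) : last_free f -> last_free (- f).
Proof. by move=> Hf m; rewrite (perm_mem (msuppN f)) => /Hf. Qed.

Lemma last_freeM (n : nat) (f g : {mpoly int[n.+1]}) :
  last_free f -> last_free g -> last_free (f * g).
Proof.
move=> Hf Hg m /msuppM_le/allpairsP[[m1 m2] /= [/Hf E1 /Hg E2 ->]].
by rewrite mnmDE E1 E2.
Qed.

Lemma last_free_nat (n k : nat) : last_free (k%:R : {mpoly int[n.+1]}).
Proof.
elim: k => [|k IH]; first exact: last_free0.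
rewrite mulrS; apply: last_freeD IH; exact: last_free1.
Qed.

Lemma last_free_det (n m : nat) (M : 'M[{mpoly int[n.+1]}]_m) :
  (forall i j, last_free (M i j)) -> last_free (\det M).
Proof.
move=> HM; apply: big_ind => [|f g|s _]; first exact: last_free0.
  exact: last_freeD.
apply: last_freeM.
  by case: odd_perm; [apply: last_freeN|]; apply: last_free1.
apply: big_ind => [|f g|i _]; [exact: last_free1|exact: last_freeM|exact: HM].
Qed.

Lemma last_free_hsum (n k r : nat) : (k <= n)%N -> last_free (hsum (xvar n.+1) k r).
Proof.
elim: k r => [|k IH] r kn; first by rewrite hsum0n; apply: last_free_nat.
elim: r => [|r IHr]; first by rewrite hsum0; apply: last_free1.
rewrite hsumSS; apply: last_freeD; first by apply: IH; apply: ltnW.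
apply: last_freeM => //.
rewrite /xvar; case: insubP => [i _ ik|_] m; last by rewrite msupp0.
rewrite msuppX inE => /eqP->; rewrite mnm1E.
by case: eqP => // E; move: kn; rewrite -ik E /= ltnn.
Qed.

Lemma last_free_excmx (n : nat) (w : 'S_n.+1) : last_free (\det (excmx w)).
Proof.
apply: last_free_det => i j; rewrite mxE; case: ifP => [|_]; last exact: last_free_nat.
rewrite inE => jw; rewrite /hval; case: ifP => _; last exact: last_free0.
by apply: last_free_hsum; apply: leq_trans jw _; rewrite -ltnS.
Qed.

Lemma schubert_last_free (n : nat) (w : 'S_n.+1) : last_free (schubert w).
Proof. by move=> m /schubert_staircase[/(_ ord_max) /=]; rewrite subnn leqn0 => /eqP. Qed.

(** A polynomial invariant under the adjacent transpositions of the variables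
    that does not involve the last variable is constant. *)
Lemma sym_last_free_const (n : nat) (f : {mpoly int[n.+1]}) :
  (forall i j : 'I_n.+1, j = i.+1 :> nat -> msym (tperm i j) f = f) ->
  last_free f -> forall m, m \in msupp f -> m = 0%MM.
Proof.
move=> fs fl.
have H (k : nat) (i : 'I_n.+1) (m : 'X_{1..n.+1}) :
    (i + k = n)%N -> m \in msupp f -> m i = 0%N.
  elim: k i m => [|k IH] i m ik mf.
    have -> : i = ord_max by apply: val_inj => /=; move: ik; rewrite addn0.
    exact: fl.
  have jn : (i.+1 < n.+1)%N by lia.
  pose j := Ordinal jn; have ij : j = i.+1 :> nat by [].
  have <- : [multinom m (tperm i j l) | l < n.+1]%MM j = m i by rewrite mnmE tpermR.
  apply: IH => /=; first by lia.
  rewrite mcoeff_msupp -(mcoeff_sym f (tperm i j) m).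
  by rewrite (fs i j ij) -mcoeff_msupp.
move=> m mf; apply/mnmP=> i; rewrite mnm0E.
by apply: (H (n - i)%N) => //; have := ltn_ord i; lia.
Qed.

Lemma hsum_const (R R' : comNzRingType) (s : {rmorphism R -> R'})
    (x : nat -> R) (k r : nat) :
  (forall l, s (x l) = 0) -> s (hsum x k r) = (r == 0%N)%:R.
Proof.
move=> sx; elim: k r => [|k IH] [|r]; rewrite ?hsum0n ?hsum0 ?rmorph_nat ?rmorph1 //.
by rewrite hsumSS rmorphD rmorphM sx mul0r addr0 IH.
Qed.

Lemma mcoeff0_xvar (N l : nat) : (xvar N l)@_0%MM = 0.
Proof.
rewrite /xvar; case: insubP => [i _ _|_]; last exact: mcoeff0.
by rewrite mcoeffX; case: eqP => // /(congr1 (@mdeg N)); rewrite mdeg1 mdeg0.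
Qed.

Lemma mcoeff0_hval (N p q : nat) : (hval (xvar N) p q)@_0%MM = (p == q)%:R.
Proof.
rewrite /hval; have [pq|qp] := leqP p q; last first.
  by rewrite mcoeff0; case: eqP => // E; rewrite E ltnn in qp.
rewrite (hsum_const (s := mcoeff 0%MM)) => [|l]; last exact: mcoeff0_xvar.
by rewrite subn_eq0 eqn_leq pq.
Qed.

Lemma excmx_const0 (N : nat) (w : 'S_N) : avoids_321 w -> w != 1%g ->
  (\det (excmx w))@_0%MM = 0.
Proof.
move=> hw /exists_descent[i0 [j0 ij0 wij0]]; have [iw _ _] := descent_exc hw ij0 wij0.
case: (arg_minnP (fun i : 'I_N => i : nat) iw) => f fmem fmin.
have fw : f \in exc w := fmem.
pose p := (w^-1)%g f; have wp : w p = f by rewrite permKV.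
have pw : p \notin exc w.
  apply/negP=> pw; have := fmin p pw; rewrite leqNgt; case/negP.
  by move: pw; rewrite inE wp.
have pf : p != f by apply: contraNneq pw => ->.
(* the constant terms of columns p and f are both the unit column p *)
rewrite -(det_map_mx (mcoeff 0%MM)) /=; apply: (det_eq_cols pf) => a.
rewrite !mxE fw (negbTE pw) mcoeff0_hval.
transitivity ((a == p)%:R : int); first by case: (a == p); rewrite ?mcoeff0 ?mcoeff1 ?eqxx.
by rewrite -(inj_eq (@perm_inj _ w)) wp eq_sym.
Qed.

Lemma schubert_const0 (N : nat) (w : 'S_N) : (0 < ninv w)%N ->
  (schubert w)@_0%MM = 0.
Proof.
move=> w0; apply/eqP; rewrite mcoeff_eq0; apply/negP=> /schubert_staircase[_].
by rewrite mdeg0 => E; rewrite -E in w0.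
Qed.

(** The Schubert polynomial of a 321-avoiding permutation is a flagged
    determinant. *)
Lemma schubert_321 (N : nat) (w : 'S_N) : avoids_321 w ->
  schubert w = \det (excmx w).
Proof.
elim/perm_descent_ind: w => [_|w i0 j0 ij0 wij0 IH hw].
  by rewrite schubert1 excmx1.
have w1 : w != 1%g by apply: contraTneq wij0 => ->; rewrite !perm1 ij0; lia.
have w0 : (0 < ninv w)%N.
  have := ninv_adj (w := (tperm i0 j0 * w)%g) ij0.
  by rewrite tperm_mulL tperm_mulR mulgA tperm2 mul1g => /(_ wij0) ->.
case: N w i0 j0 ij0 wij0 IH hw w1 w0 => [|n] w i0 j0 ij0 wij0 IH hw w1 w0.
  by case: i0 ij0 wij0.
pose f := schubert w - \det (excmx w).
have fs (i j : 'I_n.+1) : j = i.+1 :> nat -> msym (tperm i j) f = f.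
  move=> ij; have nij := adj_neq ij; apply: divdiff_eq0.
  rewrite /f divdiffD // divdiffN //; apply/eqP; rewrite subr_eq0; apply/eqP.
  have /orP[lt|gt] := adj_cases w ij.
    by rewrite divdiff_schubert_ascent // divdiff_excmx_ascent.
  rewrite divdiff_schubert_descent // divdiff_excmx_descent //.
  by apply: IH => //; apply: avoids_321_descent.
have fl : last_free f.
  apply: last_freeD; first exact: schubert_last_free.
  exact/last_freeN/last_free_excmx.
have f0 : f@_0%MM = 0.
  by rewrite mcoeffB schubert_const0 // excmx_const0 // subr0.
apply/eqP; rewrite -subr_eq0 -/f; apply/eqP/mpolyP=> m; rewrite mcoeff0.
apply/eqP; rewrite mcoeff_eq0; apply/negP=> mf.
have m0 := sym_last_free_const fs fl mf.
by move: mf; rewrite m0 mcoeff_msupp f0 eqxx.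
Qed.

(** * Independence of the products of elementary symmetric polynomials *)

Lemma esum_gt (R : comNzRingType) (x : nat -> R) (k r : nat) : (k < r)%N ->
  esum x k r = 0.
Proof.
elim: k r => [|k IH] [|r] // kr; rewrite esumSS !IH ?mulr0 ?addr0 //.
exact: ltnW.
Qed.

Lemma prod_esum (R : comNzRingType) (x : nat -> R) (y : R) (k : nat) :
  \prod_(i < k) (x i + y) = \sum_(r < k.+1) esum x k r * y ^+ (k - r).
Proof.
elim: k => [|k IH]; first by rewrite big_ord0 big_ord1 esum0 mulr1.
rewrite big_ord_recr /= IH mulrDr [RHS]big_ord_recl /= esum0 subn0 mul1r.
under [in RHS]eq_bigr => r _ do rewrite /bump leq0n add1n esumSS subSS mulrDl.
rewrite big_split /= addrA [RHS]addrC; congr (_ + _).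
  by rewrite mulr_suml; apply: eq_bigr => r _; ring.
rewrite big_ord_recl big_ord_recr /= esum0 subn0 mul1r mulrDl -exprSr.
rewrite (esum_gt x (ltnSn k)) mul0r addr0 mulr_suml; congr (_ + _).
apply: eq_bigr => r _; rewrite /bump leq0n add1n -mulrA -exprSr.
by congr (_ * _ ^+ _); have := ltn_ord r; lia.
Qed.

Lemma rmorph_esum (R R' : comNzRingType) (s : {rmorphism R -> R'}) (x : nat -> R)
    (k r : nat) :
  s (esum x k r) = esum (fun l => s (x l)) k r.
Proof.
elim: k r => [|k IH] [|r]; rewrite ?esum0 ?rmorph1 //.
  by rewrite /esum rmorph0.
by rewrite !esumSS rmorphD rmorphM !IH.
Qed.

Lemma elem_symE (N r k : nat) : (k <= N)%N -> elem_sym N r k = esum (xvar N) k r.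
Proof.
rewrite /elem_sym; elim: k r => [|k IH] r kN.
  have E : [set i : 'I_N | (i < 0)%N] = set0 by apply/setP=> i; rewrite !inE ltn0.
  rewrite E; case: r => [|r]; rewrite /esum /=.
    rewrite (big_pred1 set0) ?big_set0 // => A; rewrite subset0 /=.
    by case: eqP => // ->; rewrite cards0.
  rewrite big1 // => A /andP[]; rewrite subset0 => /eqP->.
  by rewrite cards0.
pose i0 := Ordinal kN.
have ES : [set i : 'I_N | (i < k.+1)%N] = i0 |: [set i : 'I_N | (i < k)%N].
  by apply/setP=> i; rewrite !inE -val_eqE /= ltnS leq_eqVlt.
have ni0 : i0 \notin [set i : 'I_N | (i < k)%N] by rewrite inE ltnn.
rewrite (bigID (fun A : {set 'I_N} => i0 \notin A)) /=.
have EA : \sum_(A : {set 'I_N} | (A \subset [set i : 'I_N | (i < k.+1)%N])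
      && (#|A| == r) && (i0 \notin A)) \prod_(i in A) 'X_i
    = esum (xvar N) k r :> {mpoly int[N]}.
  rewrite -IH ?(ltnW kN) //; apply: eq_bigl => A; rewrite ES andbAC; congr (_ && _).
  apply/andP/idP => [[sA nA]|sA].
    apply/subsetP=> i iA; have := subsetP sA i iA; rewrite in_setU1 => /orP[/eqP ii|//].
    by rewrite -ii iA in nA.
  split; first by apply: subset_trans sA (subsetUr _ _).
  by apply: contra ni0 => /(subsetP sA).
rewrite EA; case: r {EA} => [|r].
  rewrite big1 ?addr0 ?esum0 // => A /andP[/andP[_]].
  by rewrite cards_eq0 => /eqP->; rewrite inE.
rewrite esumSS; congr (_ + _); rewrite -IH ?(ltnW kN) //.
rewrite -[k : nat]/(nat_of_ord i0) xvarE mulr_sumr.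
rewrite (reindex_onto (fun A => i0 |: A) (fun A => A :\ i0)) => [|A /andP[_]]; last first.
  by rewrite negbK => /setD1K.
apply: eq_big => [A|A /andP[/andP[/andP[_ _] _] /eqP EA]]; last first.
  by rewrite big_setU1 //= -EA setD11.
rewrite negbK setU11 andbT ES /=.
apply/andP/andP => [[/andP[sA cA] /eqP EA]|[sA cA]].
  have nA : i0 \notin A by rewrite -EA setD11.
  rewrite cardsU1 nA add1n eqSS in cA; split=> //.
  apply/subsetP=> i iA; have := subsetP sA i.
  rewrite !in_setU1 iA orbT => /(_ isT)/orP[/eqP ii|//].
  by rewrite -ii iA in nA.
have nA : i0 \notin A by apply: contra ni0 => /(subsetP sA).
by rewrite setUS // cardsU1 nA add1n eqSS cA setU1K // eqxx.
Qed.

Lemma bigA_distr_dffun (R : comNzRingType) (I : finType) (T : I -> finType)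
    (F : forall i, T i -> R) :
  \prod_i \sum_(j : T i) F i j
  = \sum_(f : {dffun forall i, T i}) \prod_i F i (f i).
Proof.
pose P i := [ffun j => F i j].
transitivity (\sum_(t : fprod T) \prod_(i in I) P i (t i)).
  rewrite big_fprod.
  rewrite -(bigA_distr_big_dep (fun i => tagged_with T i) (fun i => untag 0 (P i))).
  by apply: eq_bigr => i _; rewrite -(big_tag P); apply: eq_bigr => j _; rewrite ffunE.
rewrite (reindex (@fprod_of_dffun I T)); last exact/onW_bij/fprod_of_dffun_bij.
apply: eq_bigr => f _; apply: eq_bigr => i _.
by rewrite ffunE fprodE.
Qed.

Lemma card_multi_index (N : nat) : #|multi_index N| = #|{: 'S_N}|.
Proof.
rewrite (bij_eq_card (@fprod_of_dffun_bij _ _)) card_fprod.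
transitivity (N`!); last by rewrite card_Sn.
rewrite fact_prod big_add1 big_mkord; apply: eq_bigr => k _; exact: card_ord.
Qed.

(** The point (u(0), ..., u(N-1)) at which polynomials are evaluated. *)
Definition perm_point (N : nat) (u : 'S_N) (i : 'I_N) : int := (u i : nat)%:Z.

(** If the kernel is nonzero then, for every k, v(k) is none of u(0), ..., u(k-1);
    this forces u = v. *)
Lemma kernel_point (N : nat) (u v : 'S_N) :
  (\prod_(k < N) \prod_(i < N | (i < k)%N) (perm_point u i - perm_point v k) != 0)
  = (u == v).
Proof.
apply/prodf_neq0/eqP => [H|-> k _]; last first.
  apply/prodf_neq0 => i ik; rewrite subr_eq0 /perm_point eqz_nat val_eqE.
  by rewrite (inj_eq perm_inj) -val_eqE neq_ltn ik.
suff E : (v * u^-1)%g = 1%g by apply/esym/eqP; rewrite eq_mulgV1 E.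
apply: perm_ge_id => k; rewrite leqNgt; apply/negP=> lt.
have /prodf_neq0/(_ _ lt) := H k isT.
by rewrite subr_eq0 /perm_point permM permKV eqxx.
Qed.

(** The value at the point u of the product of the e_{m(k)}(x_0, ..., x_{k-1}). *)
Definition elem_eval (N : nat) (u : 'S_N) (m : multi_index N) : int :=
  (\prod_(k < N) elem_sym N (m k) k).@[perm_point u].

Lemma elem_kernel (N : nat) (u v : 'S_N) :
  \sum_(m : multi_index N) elem_eval u m * \prod_(k < N) (- perm_point v k) ^+ (k - m k)
  = \prod_(k < N) \prod_(i < N | (i < k)%N) (perm_point u i - perm_point v k).
Proof.
pose x l : int := (xvar N l).@[perm_point u].
have xE (i : 'I_N) : x i = perm_point u i by rewrite /x xvarE mevalXU.
transitivity (\prod_(k < N) \sum_(r < k.+1) esum x k r * (- perm_point v k) ^+ (k - r)).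
  rewrite bigA_distr_dffun; apply: eq_bigr => m _.
  rewrite /elem_eval rmorph_prod -big_split; apply: eq_bigr => k _ /=.
  by rewrite elem_symE ?rmorph_esum // ltnW.
apply: eq_bigr => k _; rewrite -prod_esum.
rewrite [RHS](big_ord_narrow (ltnW (ltn_ord k))); apply: eq_bigr => i _.
by rewrite -xE.
Qed.

(** The N! x N! matrix of the values of the products at the points u is invertible
    over the rationals, since by [elem_kernel] its product with a square matrix is
    diagonal with nonzero diagonal entries. *)
Lemma elem_independent (N : nat) (a : multi_index N -> int) :
  \sum_(m : multi_index N) a m *: \prod_(k < N) elem_sym N (m k) k = 0 ->
  forall m, a m = 0.
Proof.
move=> a0.
pose n := #|{: 'S_N}|.
pose idx (c : 'I_n) := enum_val (cast_ord (esym (card_multi_index N)) c).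
have idx_bij : bijective idx.
  exists (fun m => cast_ord (card_multi_index N) (enum_rank m)) => [c|m].
    by rewrite /idx enum_valK cast_ordKV.
  by rewrite /idx cast_ordK enum_rankK.
pose E : 'M[int]_n := \matrix_(b, c) elem_eval (enum_val b) (idx c).
pose Y : 'M[int]_n :=
  \matrix_(c, b) \prod_(k < N) (- perm_point (enum_val b) k) ^+ (k - idx c k).
pose A : 'cV[int]_n := \col_c a (idx c).
have EY b c : (E *m Y) b c
    = \prod_(k < N) \prod_(i < N | (i < k)%N)
        (perm_point (enum_val b) i - perm_point (enum_val c) k).
  rewrite mxE -elem_kernel [RHS](reindex idx) /=; last exact: onW_bij.
  by apply: eq_bigr => d _; rewrite !mxE.
have dE : \det E != 0.
  have : \det (E *m Y) != 0.
    rewrite det_trig.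
      by apply/prodf_neq0 => b _; rewrite EY kernel_point.
    apply/is_trig_mxP => b c bc; apply/eqP; rewrite EY -[_ == 0]negbK kernel_point.
    by rewrite (inj_eq enum_val_inj) -val_eqE neq_ltn bc.
  by rewrite det_mulmx mulf_eq0 negb_or => /andP[].
have EA : E *m A = 0.
  apply/colP=> b; rewrite !mxE.
  have := congr1 (meval (perm_point (enum_val b))) a0.
  rewrite meval0 rmorph_sum /= => H; rewrite -[RHS]H.
  rewrite [RHS](reindex idx) /=; last exact: onW_bij.
  by apply: eq_bigr => c _; rewrite !mxE mevalZ mulrC.
have A0 : A = 0.
  have := congr1 (mulmx (\adj E)) EA; rewrite mulmxA mul_adj_mx mulmx0 mul_scalar_mx.
  move/matrixP=> H; apply/colP=> c; have := H c ord0; rewrite !mxE => /eqP.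
  by rewrite mulf_eq0 (negbTE dE) => /eqP.
move=> m; case: idx_bij => g gK Kg; have /colP/(_ (g m)) := A0.
by rewrite !mxE Kg.
Qed.

(** * Complementary minors of a unitriangular matrix *)

Lemma enum_val_ltn (N : nat) (S : {set 'I_N}) (a b : 'I_#|S|) : (a < b)%N ->
  (enum_val a < enum_val b)%N.
Proof.
move=> ab.
have lt_tr : transitive (fun i j : 'I_N => i < j)%N by move=> y x z; apply: ltn_trans.
have srt : sorted (fun i j : 'I_N => i < j)%N (enum S).
  rewrite {1}/enum_mem -enumT; apply: sorted_filter => //.
  by rewrite -(@sorted_map _ _ val ltn) val_enum_ord; apply: iota_ltn_sorted.
rewrite /enum_val (set_nth_default (enum_default b) (enum_default a)) -?cardE //.
by apply: (sorted_ltn_nth lt_tr) => //; rewrite inE -cardE.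
Qed.

Lemma imset_enum_val (N : nat) (S : {set 'I_N}) :
  S = (fun a : 'I_#|S| => enum_val a) @: setT.
Proof.
apply/setP=> i; apply/idP/imsetP => [iS|[a _ ->]]; last exact: enum_valP.
by exists (enum_rank_in iS i); rewrite ?enum_rankK_in.
Qed.

Lemma minor_perm (R : comNzRingType) (N : nat) (Z : 'M[R]_N) (w : 'S_N) (S : {set 'I_N}) :
  {in S &, forall i j : 'I_N, (i < j)%N -> (w i < w j)%N} ->
  minor Z (w @: S) S = \det (principal_mx S (row_perm w Z)).
Proof.
move=> winc; rewrite (det_principal _ enum_val_inj (imset_enum_val S)).
rewrite (minor_incr Z (f := fun a : 'I_#|S| => w (enum_val a)) (g := enum_val)) //.
- by congr (\det _); apply/matrixP=> a b; rewrite !mxE.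
- by move=> a b /enum_val_ltn; apply: winc; apply: enum_valP.
- by move=> a b /enum_val_ltn.
- by rewrite [in LHS](imset_enum_val S) -imset_comp.
- exact: imset_enum_val.
Qed.

(** Upper triangular with ones on the diagonal. *)
Definition unitriangular (R : nzRingType) (N : nat) (Z : 'M[R]_N) : Prop :=
  forall i j : 'I_N, (j <= i)%N -> Z i j = (i == j)%:R.

Lemma det_unitriangular (R : comNzRingType) (N : nat) (Z : 'M[R]_N) :
  unitriangular Z -> \det Z = 1.
Proof.
move=> HZ; rewrite -det_tr det_trig.
  by rewrite big1 // => i _; rewrite mxE HZ // eqxx.
apply/is_trig_mxP=> i j ij; rewrite mxE HZ; last exact: ltnW.
by rewrite -val_eqE /= gtn_eqF.
Qed.

Lemma mul_unitriangular_adj (R : comNzRingType) (N : nat) (Z : 'M[R]_N) :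
  unitriangular Z -> Z *m \adj Z = 1%:M.
Proof. by move=> HZ; rewrite mul_mx_adj det_unitriangular. Qed.

Lemma mul_adj_unitriangular (R : comNzRingType) (N : nat) (Z : 'M[R]_N) :
  unitriangular Z -> \adj Z *m Z = 1%:M.
Proof. by move=> HZ; rewrite mul_adj_mx det_unitriangular. Qed.

Lemma det_adj_unitriangular (R : comNzRingType) (N : nat) (Z : 'M[R]_N) :
  unitriangular Z -> \det (\adj Z) = 1.
Proof.
move=> HZ; have := congr1 determinant (mul_unitriangular_adj HZ).
by rewrite det_mulmx det1 (det_unitriangular HZ) mul1r.
Qed.

Lemma unitriangular_adj (R : comNzRingType) (N : nat) (Z : 'M[R]_N) :
  unitriangular Z -> unitriangular (\adj Z).
Proof.
move=> HZ; have := mul_adj_unitriangular HZ; move: (\adj Z) => K KZ p q.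
have [n] := ubnP q; elim: n q => // n IH q qn qp.
have /matrixP/(_ p q) := KZ; rewrite !mxE (bigD1 q) //=.
rewrite HZ // eqxx mulr1 big1 ?addr0 // => s sq.
case: (ltngtP s q) => [lt|gt|/val_inj E]; last by rewrite E eqxx in sq.
  rewrite IH ?(ltn_leq_trans lt) //; first last.
  - by apply: leq_trans qp; apply: ltnW.
  - by apply: leq_trans lt _; rewrite -ltnS.
  have -> : (p == s) = false by rewrite -val_eqE /= gtn_eqF // (leq_trans lt).
  by rewrite mul0r.
by rewrite HZ ?(ltnW gt) // -val_eqE /= gtn_eqF // mulr0.
Qed.

(** The set of anti-excedances. *)
Definition aexc (N : nat) (w : 'S_N) : {set 'I_N} := [set i : 'I_N | (w i < i)%N].

(** The two sides differ only in the rows of the fixed points k of w, and agree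
    term by term in the expansion of the determinants. A term that does not pick
    the diagonal entry of row k vanishes: on the right because this is a unit row,
    on the left because k splits the matrix into diagonal blocks. *)
Lemma det_principal_fixed (R : comNzRingType) (N : nat) (Z : 'M[R]_N) (w : 'S_N) :
  unitriangular Z -> avoids_321 w ->
  \det (principal_mx (~: exc w) (row_perm w Z))
  = \det (principal_mx (aexc w) (row_perm w Z)).
Proof.
move=> HZ hw; apply: eq_bigr => s _; congr (_ * _).
have [/existsP[k /andP[/eqP wk sk]]|nE] :=
  boolP [exists k : 'I_N, (w k == k) && (s k != k)].
  rewrite [RHS](bigD1 k) //= [X in _ = X * _]mxE !inE wk ltnn eq_sym (negbTE sk) mul0r.
  pose A := \matrix_(i, j) if (i == k) && (j == k) then 0
    else principal_mx (~: exc w) (row_perm w Z) i j.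
  transitivity (\prod_i A i (s i)).
    apply: eq_bigr => i _; rewrite [in RHS]mxE.
    by case: eqP => [->|]; rewrite // (negbTE sk).
  pose I := exc w :|: [set i : 'I_N | (k <= i)%N].
  pose J := [set j : 'I_N | (j \notin exc w) && (j <= k)%N].
  have kw : k \notin exc w by rewrite inE wk ltnn.
  apply: (prod_zero_block s (I := I) (J := J)) => [i j|].
    rewrite in_setU !in_set => iI /andP[jw jk]; rewrite !mxE !inE.
    case: ifP => // /negbT; rewrite negb_and => ijk.
    have [iw|iw] := boolP (i < w i)%N; last first.
      rewrite (negbTE iw) /= in iI.
      have wij : (j < w i)%N.
        move: iI; rewrite leq_eqVlt => /orP[/eqP/val_inj E|ki].
          rewrite -E wk ltn_neqAle jk andbT.
          by move: ijk; rewrite -E eqxx.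
        by apply: leq_ltn_trans jk _; have := nonexc_lt hw kw ki; rewrite wk.
      by rewrite HZ ?(ltnW wij) // -val_eqE /= gtn_eqF.
    by case: eqP => // E; rewrite -E iw in jw.
  have -> : J = ~: (I :\ k).
    apply/setP=> b; rewrite !inE -[b == k]val_eqE /=.
    by case: (ltngtP b k) => [||/val_inj->]; rewrite ?wk; lia.
  have kI : k \in I by rewrite !inE leqnn orbT.
  have := cardsC (I :\ k); rewrite card_ord => {1}<-.
  by rewrite ltn_add2r [in X in (_ < X)%N](cardsD1 k) kI.
apply: eq_bigr => i _; rewrite !mxE !inE.
case: (ltngtP i (w i)) => [//|//|/val_inj E].
have wi : w i = i by rewrite -E.
have si : s i = i.
  by apply/eqP; apply: contraNT nE => sk; apply/existsP; exists i; rewrite wi eqxx.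
by rewrite si wi HZ // eqxx.
Qed.

Lemma imset_exc_inv (N : nat) (w : 'S_N) : exc (w^-1)%g = w @: aexc w.
Proof.
apply/setP=> i; rewrite inE; apply/idP/imsetP => [lt|[j]]; last first.
  by rewrite inE => lt ->; rewrite permK.
by exists ((w^-1)%g i); rewrite ?inE permKV.
Qed.

Lemma exc_val_inv (N : nat) (w : 'S_N) : exc_val (w^-1)%g = aexc w.
Proof.
rewrite /exc_val imset_exc_inv -imset_comp (eq_imset (g := id)) ?imset_id //.
by move=> i /=; rewrite permK.
Qed.

Lemma exc_valC (N : nat) (w : 'S_N) : ~: exc_val w = w @: (~: exc w).
Proof.
apply/setP=> i; rewrite -[i](permKV w) inE !(mem_imset _ _ (@perm_inj _ w)).
by rewrite in_setC.
Qed.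

Lemma minor_exc_complement (R : comNzRingType) (N : nat) (Z : 'M[R]_N) (w : 'S_N) :
  avoids_321 w ->
  minor Z (~: exc_val w) (~: exc w) = \det (principal_mx (~: exc w) (row_perm w Z)).
Proof.
move=> hw; rewrite exc_valC minor_perm // => i j; rewrite !in_setC => iw _.
exact: nonexc_lt.
Qed.

Lemma minor_exc_inv (R : comNzRingType) (N : nat) (Z : 'M[R]_N) (w : 'S_N) :
  unitriangular Z -> avoids_321 w ->
  minor Z (exc (w^-1)%g) (exc_val (w^-1)%g) = minor Z (~: exc_val w) (~: exc w).
Proof.
move=> HZ hw; rewrite exc_val_inv imset_exc_inv minor_exc_complement //.
rewrite det_principal_fixed // minor_perm // => i j; rewrite inE => iw _.
by apply: nonexc_lt => //; rewrite inE -leqNgt ltnW.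
Qed.

(** The cyclic permutation that moves p to q and shifts the interval ]p, q] down
    by one. Its only possible excedance is p. *)
Lemma lift_permE (n : nat) (p q i : 'I_n.+1) : (p <= q)%N ->
  lift_perm p q 1 i = (if i == p :> nat then q : nat else
     if (p < i)%N && (i <= q)%N then i.-1 else i) :> nat.
Proof.
move=> pq; case: (unliftP p i) => [k|] ->; last by rewrite eqxx lift_perm_id.
rewrite lift_perm_lift perm1 /= /bump.
by case: eqP => [|_]; [|case: ifP]; lia.
Qed.

Lemma avoids_321_lift_perm (n : nat) (p q : 'I_n.+1) : (p <= q)%N ->
  avoids_321 (lift_perm p q 1).
Proof.
move=> pq a b c ab bc []; rewrite !lift_permE //.
by do ![case: ifP => ?]; lia.
Qed.

(** h_r(p) is, up to sign, an entry of the inverse matrix: Jacobi's identity for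
    the permutation [lift_perm p q 1]. *)
Lemma minor_interval_adj (R : comNzRingType) (N : nat) (Z : 'M[R]_N) (p q : 'I_N) :
  unitriangular Z -> (p <= q)%N ->
  minor Z [set i : 'I_N | (p <= i < p + (q - p))%N]
          [set j : 'I_N | (p < j <= p + (q - p))%N]
  = (-1) ^+ (q - p) * (\adj Z) p q.
Proof.
case: N Z p q => [Z []//|n] Z p q HZ pq; rewrite subnKC //.
pose w := lift_perm p q 1; have hw : avoids_321 w by apply: avoids_321_lift_perm.
have aw : aexc w = [set j : 'I_n.+1 | (p < j <= q)%N].
  by apply/setP=> j; rewrite !inE lift_permE //; do ![case: ifP => ?]; lia.
have rw : w @: aexc w = [set i : 'I_n.+1 | (p <= i < q)%N].
  apply/setP=> i; rewrite -[i](permKV w) (mem_imset _ _ (@perm_inj _ w)) !inE.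
  by move: (w^-1 i)%g => j; rewrite !lift_permE //; do ![case: ifP => ?]; lia.
have [E|npq] := eqVneq p q.
  have aw0 : aexc w = set0 by rewrite aw E; apply/setP=> j; rewrite !inE; lia.
  rewrite -rw -aw aw0 imset0 -E subnn unitriangular_adj // eqxx mulr1.
  rewrite (minor_incr _ (f := fun a : 'I_0 => p) (g := fun a : 'I_0 => p));
    rewrite ?det_mx00 //; try by case.
  - by apply/setP=> i; rewrite inE; apply/esym/imsetP => -[[]].
  - by apply/setP=> i; rewrite inE; apply/esym/imsetP => -[[]].
have lpq : (p < q)%N by rewrite ltn_neqAle npq.
have ew : exc w = [set p].
  by apply/setP=> j; rewrite !inE lift_permE // -val_eqE /=; do ![case: ifP => ?]; lia.
rewrite -rw -aw minor_perm; last first.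
  by move=> i j; rewrite inE => iw _; apply: nonexc_lt => //; rewrite inE -leqNgt ltnW.
rewrite -det_principal_fixed //.
rewrite (det_principal_jacobi _ _ (mul_unitriangular_adj HZ) (det_adj_unitriangular HZ)).
rewrite setCK ew (det_principal (f := fun _ : 'I_1 => p) _) ?det_mx11; first last.
- by apply/setP=> i; rewrite inE; apply/eqP/imsetP => [->|[]//]; exists ord0.
- by move=> a b _; rewrite !ord1.
rewrite !mxE lift_perm_id odd_lift_perm odd_perm1 addbF; congr (_ * _).
by rewrite -[RHS]signr_odd oddB // addbC.
Qed.

(** * Specialization of the universal Schubert polynomial *)

Lemma Zc_cvar (N : nat) (p q : 'I_N) :
  Zc N p q = if (p <= q)%N then cvar (q - p)%N%:Z q else 0.
Proof. by rewrite mxE; case: leqP => // pq; rewrite subzn. Qed.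

Lemma unitriangular_Zc (N : nat) : unitriangular (Zc N).
Proof.
move=> i j ji; rewrite Zc_cvar -val_eqE /=; case: leqP => ij; last by rewrite gtn_eqF.
have E : (i : nat) = j by apply/eqP; rewrite eqn_leq ij ji.
by rewrite E subnn eqxx.
Qed.

Lemma hvar_adj (N : nat) (p q : 'I_N) :
  hvar (q%:Z - p%:Z) p = (-1) ^+ (q + p) * (\adj (Zc N)) p q.
Proof.
have [pq|qp] := leqP p q.
  rewrite subzn //= minor_interval_adj //; last exact: unitriangular_Zc.
  by rewrite -[(-1) ^+ (q - p)]signr_odd -[(-1) ^+ (q + p)]signr_odd oddB // oddD.
rewrite (unitriangular_adj (@unitriangular_Zc N)); last exact: ltnW.
rewrite -val_eqE /= gtn_eqF // mulr0.
by have -> : q%:Z - p%:Z = Negz (p - q).-1 by lia.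
Qed.

Lemma exc_val_nthE (N : nat) (w : 'S_N) (i : 'I_#|exc w|) : avoids_321 w ->
  exc_val_nth i = w (exc_nth i).
Proof.
move=> hw.
have [||e E] := @enum_val_incr N #|exc w| (fun a => w (enum_val a)) (exc_val w).
- by move=> a b /enum_val_ltn; apply: exc_gt => //; apply: enum_valP.
- by rewrite /exc_val [in LHS](imset_enum_val (exc w)) -imset_comp.
rewrite /exc_val_nth E /exc_nth; congr (w (enum_val _)).
exact: val_inj.
Qed.

Lemma det_scale_rows_cols (R : comNzRingType) (n : nat) (c d : 'I_n -> R)
    (M : 'M[R]_n) :
  \det (\matrix_(i, j) (c i * d j * M i j)) = (\prod_i (c i * d i)) * \det M.
Proof.
have -> : \matrix_(i, j) (c i * d j * M i j)
    = diag_mx (\row_i c i) *m M *m diag_mx (\row_i d i).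
  apply/matrixP=> i j; rewrite mul_diag_mx mul_mx_diag !mxE; ring.
rewrite !det_mulmx !det_diag mulrAC -big_split /=; congr (_ * _).
by apply: eq_bigr => i _; rewrite !mxE.
Qed.

Lemma det_signed_adj (R : comNzRingType) (N : nat) (Z : 'M[R]_N) (w : 'S_N) :
  unitriangular Z -> avoids_321 w ->
  \det (\matrix_(i < #|exc w|, j < #|exc w|)
         ((-1) ^+ (w (enum_val i) + enum_val j) * (\adj Z) (enum_val j) (w (enum_val i))))
  = \det (principal_mx (~: exc w) (row_perm w Z)).
Proof.
move=> HZ hw.
rewrite (det_principal_jacobi _ _ (mul_unitriangular_adj HZ) (det_adj_unitriangular HZ)).
rewrite setCK (det_principal _ enum_val_inj (imset_enum_val (exc w))) -[in RHS]det_tr.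
pose sg (i : 'I_#|exc w|) : R := (-1) ^+ w (enum_val i).
pose sf (j : 'I_#|exc w|) : R := (-1) ^+ enum_val j.
have := det_scale_rows_cols sg sf (\matrix_(i, j) (\adj Z) (enum_val j) (w (enum_val i))).
under eq_mx => i j do rewrite mxE -exprD.
move=> ->.
have -> : (\matrix_(i, j) col_perm w (\adj Z) (enum_val i) (enum_val j))^T
    = \matrix_(i < #|exc w|, j < #|exc w|) (\adj Z) (enum_val j) (w (enum_val i)).
  by apply/matrixP=> i j; rewrite [LHS]mxE [LHS]mxE [LHS]mxE [RHS]mxE.
congr (_ * _).
rewrite odd_perm_321 // signr_odd -prodrXr.
rewrite (big_enum_val (fun i : 'I_N => (-1) ^+ (w i - i))) /=.
apply: eq_bigr => i _; rewrite /sg /sf -exprD.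
rewrite -[LHS]signr_odd oddD -[RHS]signr_odd oddB //.
by have := enum_valP i; rewrite inE => /ltnW.
Qed.

Lemma det_hvar (N : nat) (w : 'S_N) : avoids_321 w ->
  \det (\matrix_(i < #|exc w|, j < #|exc w|)
         hvar ((exc_val_nth i)%:Z - (exc_nth j)%:Z) (exc_nth j))
  = \det (principal_mx (~: exc w) (row_perm w (Zc N))).
Proof.
move=> hw; rewrite -(det_signed_adj (@unitriangular_Zc N) hw); congr (\det _).
by apply/matrixP=> i j; rewrite [LHS]mxE [RHS]mxE hvar_adj exc_val_nthE.
Qed.

(** The specialization of c_r(k) to e_r(x_0, ..., x_{k-1}). *)
Definition specialize (N : nat) : {rmorphism ZU N -> {mpoly int[N]}} :=
  mmap intr (fun e => let u := val (enum_val e : upos N) in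
                      esum (xvar N) u.2 (u.2 - u.1)).

Lemma specialize_zvar (N : nat) (p q : 'I_N) : (p < q)%N ->
  specialize N (zvar p q) = esum (xvar N) q (q - p).
Proof.
move=> pq; rewrite /zvar; case: insubP => [u _ Eu|]; last by rewrite pq.
by rewrite /= mmapX mmap1U enum_rankK Eu.
Qed.

Lemma specialize_cvar (N : nat) (r : nat) (k : 'I_N) : (r <= k)%N ->
  specialize N (cvar r k) = esum (xvar N) k r.
Proof.
case: r => [_|r rk]; first by rewrite rmorph1 esum0.
rewrite /cvar rk specialize_zvar /=; last by lia.
by rewrite subKn.
Qed.

Lemma specialize_Zc (N : nat) : map_mx (specialize N) (Zc N) = emx N (xvar N).
Proof.
apply/matrixP=> p q; rewrite [LHS]mxE Zc_cvar [RHS]mxE.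
by case: leqP => _; [apply: specialize_cvar; apply: leq_subr | apply: rmorph0].
Qed.

Lemma specialize_adj (N : nat) (p q : 'I_N) :
  specialize N ((\adj (Zc N)) p q) = (-1) ^+ (q - p) * hval (xvar N) p q.
Proof.
have E1 := hval_emx N (xvar N).
have := mul_unitriangular_adj (@unitriangular_Zc N).
move/(congr1 (map_mx (specialize N))); rewrite map_mxM specialize_Zc map_mx1 => E2.
have E : map_mx (specialize N) (\adj (Zc N))
    = \matrix_(a, b) ((-1) ^+ (b - a) * hval (xvar N) a b).
  by rewrite -[LHS]mul1mx -E1 -mulmxA E2 mulmx1.
by have := congr1 (fun M : 'M_N => M p q) E; rewrite [LHS]mxE [RHS]mxE.
Qed.

Lemma specialize_hvar (N : nat) (p q : 'I_N) :
  specialize N (hvar (q%:Z - p%:Z) p) = hval (xvar N) p q.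
Proof.
rewrite hvar_adj rmorphM rmorphXn rmorphN rmorph1 specialize_adj.
have [pq|qp] := leqP p q; last by rewrite /hval leqNgt qp !mulr0.
by rewrite mulrA -exprD -signr_odd oddD oddB // oddD addbb mul1r.
Qed.

Lemma specialize_det_hvar (N : nat) (w : 'S_N) : avoids_321 w ->
  specialize N (\det (\matrix_(i < #|exc w|, j < #|exc w|)
         hvar ((exc_val_nth i)%:Z - (exc_nth j)%:Z) (exc_nth j)))
  = schubert w.
Proof.
move=> hw; rewrite schubert_321 // -det_map_mx.
have -> : excmx w = (principal_mx (exc w) (\matrix_(j, i) hval (xvar N) j (w i)))^T.
  by apply/matrixP=> i j; rewrite [LHS]mxE [RHS]mxE [RHS]mxE [in RHS]mxE eq_sym.
rewrite det_tr (det_principal _ enum_val_inj (imset_enum_val (exc w))) -[RHS]det_tr.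
congr (\det _); apply/matrixP=> i j; rewrite [LHS]mxE [in LHS]mxE; do 3!rewrite [RHS]mxE.
by rewrite specialize_hvar exc_val_nthE.
Qed.

(** The integer combinations of products with exactly one factor c_r(k), r <= k,
    for each k. *)
Definition c_span (N : nat) (u : ZU N) : Prop :=
  exists a : multi_index N -> int,
    u = \sum_(m : multi_index N) (\prod_(k < N) cvar (m k : nat) k) *~ a m.

Lemma c_span0 (N : nat) : c_span (0 : ZU N).
Proof. by exists (fun=> 0); rewrite big1 // => m _; rewrite mulr0z. Qed.

Lemma c_spanD (N : nat) (u v : ZU N) : c_span u -> c_span v -> c_span (u + v).
Proof.
move=> [a ->] [b ->]; exists (fun m => a m + b m); rewrite -big_split /=.
by apply: eq_bigr => m _; rewrite mulrzDr.
Qed.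

Lemma c_spanN (N : nat) (u : ZU N) : c_span u -> c_span (- u).
Proof.
move=> [a ->]; exists (fun m => - a m); rewrite -sumrN.
by apply: eq_bigr => m _; rewrite mulrNz.
Qed.

(** Columns are indexed by k, so a product with one entry from each column of
    Z(c) is such a product, or zero. *)
Lemma c_span_prod (N : nat) (F : 'I_N -> ZU N) :
  (forall k : 'I_N, F k = 0 \/ exists r : 'I_k.+1, F k = cvar (r : nat) k) ->
  c_span (\prod_k F k).
Proof.
move=> HF; have [/existsP[k /eqP Fk]|nE] := boolP [exists k, F k == 0].
  by rewrite (bigD1 k) //= Fk mul0r; apply: c_span0.
have HF' (k : 'I_N) : exists r : 'I_k.+1, F k == cvar (r : nat) k.
  case: (HF k) => [Fk|[r ->]]; last by exists r.
  by case/negP: nE; apply/existsP; exists k; rewrite Fk.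
pose m : multi_index N := [ffun k => xchoose (HF' k)].
exists (fun m' => (m' == m)%:R).
rewrite (bigD1 m) //= [X in _ = _ + X]big1 => [|m' /negbTE->].
  rewrite eqxx addr0 mulr1z; apply: eq_bigr => k _.
  by rewrite ffunE; apply/eqP/(xchooseP (HF' k)).
by rewrite mulr0z.
Qed.

Lemma c_span_det_principal (N : nat) (w : 'S_N) (S : {set 'I_N}) :
  c_span (\det (principal_mx S (row_perm w (Zc N)))).
Proof.
apply: big_ind => [|u v|s _]; [exact: c_span0|exact: c_spanD|].
suff H : c_span (\prod_i principal_mx S (row_perm w (Zc N)) i (s i)).
  by case: odd_perm; rewrite ?expr0 ?expr1 ?mul1r // mulN1r; apply: c_spanN.
rewrite (reindex_inj (@perm_inj _ (s^-1)%g)) /=.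
apply: c_span_prod => k; rewrite permKV [principal_mx _ _ _ _]mxE.
case: ifP => _.
  rewrite [row_perm _ _ _ _]mxE Zc_cvar; case: leqP => [le|_]; last by left.
  by right; exists (Ordinal (leq_subr _ _ : (k - w ((s^-1)%g k) < k.+1)%N)).
by case: eqP => _; [right; exists ord0 | left].
Qed.

Lemma universal_schubert_span (N : nat) (w : 'S_N) (u : ZU N) :
  c_span u -> specialize N u = schubert w -> universal_schubert w = u.
Proof.
move=> [a Eu] Ew.
have Ea : elem_expansion w a.
  rewrite /elem_expansion -Ew Eu rmorph_sum; apply: eq_bigr => m _.
  rewrite rmorphMz rmorph_prod -scaler_int intz; congr (_ *: _); apply: eq_bigr => k _.
  have rk : (m k <= k)%N by rewrite -ltnS.
  exact: etrans (specialize_cvar rk) (esym (elem_symE _ (ltnW (ltn_ord k)))).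
have Ec : elem_expansion w (elem_coef w) by apply: (epsilon_spec _ _ (ex_intro _ a Ea)).
have E : forall m, elem_coef w m - a m = 0.
  apply: elem_independent.
  under eq_bigr => m _ do rewrite scalerBl.
  by rewrite sumrB -Ec -Ea subrr.
rewrite /universal_schubert Eu; apply: eq_bigr => m _; congr (_ *~ _).
by apply/eqP; rewrite -subr_eq0 E.
Qed.

Theorem theorem7p1 (N : nat) (w v : 'S_N) (hw : avoids_321 w) (hv : v = (w^-1)%g) :
  [/\ universal_schubert w
        = (\det (\matrix_(i < #|exc w|, j < #|exc w|)
                  hvar ((exc_val_nth i)%:Z - (exc_nth j)%:Z) (exc_nth j)))%R,
      (\det (\matrix_(i < #|exc w|, j < #|exc w|)
              hvar ((exc_val_nth i)%:Z - (exc_nth j)%:Z) (exc_nth j)))%R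
        = minor (Zc N) (~: exc_val w) (~: exc w)
    & minor (Zc N) (~: exc_val w) (~: exc w) = minor (Zc N) (exc v) (exc_val v)].
Proof.
have Edet := det_hvar hw; split.
- apply: universal_schubert_span; last exact: specialize_det_hvar.
  by rewrite Edet; apply: c_span_det_principal.
- by rewrite Edet minor_exc_complement.
by rewrite hv minor_exc_inv //; apply: unitriangular_Zc.
Qed.
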